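(* Let $\mathfrak{H},\mathfrak{K}$ be complex Hilbert spaces and let $T,B:\mathfrak{H}\to\mathfrak{K}$ be closed densely defined linear operators for which there exists $X\in\mathbf{B}^+(\mathfrak{K})$ with $XB\subseteq T$ (equivalently, $\mathrm{dom}\,B\subseteq\mathrm{dom}\,T$ and for some $\mu\ge0$ one has $\|Tf\|_{\mathfrak{K}}^2\le\mu\,(Tf,Bf)_{\mathfrak{K}}$ for all $f\in\mathrm{dom}\,B$). Let $X$ be such an operator, put $\lambda=\|X\|\ge0$ and $H=B^*X^{1/2}\,\overline{X^{1/2}B}$, which is a nonnegative selfadjoint operator in $\mathfrak{H}$. Then: (1) $0\le(Tf,Bf)_{\mathfrak{K}}\le\lambda\,\|Bf\|_{\mathfrak{K}}^2$ for all $f\in\mathrm{dom}\,B$; (2) the operator $T^*B$ is symmetric and, moreover, $T^*B\subseteq H\subseteq B^*T$; (3) $T^*T\le\lambda H\le\lambda^2B^*B$; (4) if $T^*B$ is selfadjoint, then $T^*B=H=B^*T$ and $$T^*T\le\lambda\,T^*B=\lambda\,B^*XB\le\lambda^2\,B^*B.$$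
   Context: Operators are linear and possibly unbounded. $\mathbf{B}^+(\mathfrak{K})$ is the set of bounded everywhere defined nonnegative operators on $\mathfrak{K}$. Inclusion of operators is inclusion of graphs; in particular $XB\subseteq T$ means $\mathrm{dom}\,B\subseteq\mathrm{dom}\,T$ and $XBf=Tf$ for all $f\in\mathrm{dom}\,B$. Products such as $T^*B$ have their natural domains. $\overline{X^{1/2}B}$ denotes the operator closure of $X^{1/2}B$ (which is closable in this situation). An operator $S$ in $\mathfrak{H}$ is symmetric if $(Sf,g)_{\mathfrak{H}}=(f,Sg)_{\mathfrak{H}}$ for all $f,g\in\mathrm{dom}\,S$ (density of the domain is not required). Inequalities between nonnegative selfadjoint operators are in the form sense: for a nonnegative selfadjoint operator $K$ in $\mathfrak{H}$ and $\lambda\ge0$, $T^*T\le\lambda K$ means $\mathrm{dom}\,K^{1/2}\subseteq\mathrm{dom}\,T$ and $\|Tf\|_{\mathfrak{K}}^2\le\lambda\|K^{1/2}f\|_{\mathfrak{H}}^2$ for all $f\in\mathrm{dom}\,K^{1/2}$; and $\lambda K\le\lambda^2B^*B$ means $\mathrm{dom}\,B\subseteq\mathrm{dom}\,K^{1/2}$ and $\lambda\|K^{1/2}f\|_{\mathfrak{H}}^2\le\lambda^2\|Bf\|_{\mathfrak{K}}^2$ for all $f\in\mathrm{dom}\,B$. *)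

(* Defs.v *)
From HB Require Import structures.
From mathcomp Require Import all_boot all_order all_algebra sesquilinear complex.
From mathcomp Require Import all_classical all_reals all_analysis.

Set Implicit Arguments.
Unset Strict Implicit.
Unset Printing Implicit Defensive.

Import Order.TTheory GRing.Theory Num.Theory.
Import numFieldNormedType.Exports.

Local Open Scope classical_set_scope.
Local Open Scope ring_scope.
Local Open Scope complex_scope.

(* The norm `|u| of a normed module over R[i] takes its values in R[i] (they
   are real). In R[i], z <= w means that w - z is a nonnegative real; thus
   0 <= z says that z is real and nonnegative. *)
HB.mixin Record isHilbert (R : realType) H & CompleteNormedModule R[i] H := {
  inner : {dot H for (@Num.conj R[i])} ;
  inner_norm : forall u : H, inner u u = `|u| ^+ 2
}.

#[short(type="hilbertType")]
HB.structure Definition Hilbert (R : realType) :=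
  { H of CompleteNormedModule R[i] H & isHilbert R H }.

(* An operator from H to K, not necessarily everywhere defined, is represented
   by its graph; inclusion of operators is then `<=`. The adjoint and the
   closure below are defined for every graph, and are in general only linear
   relations; [is_operator] singles out the graphs of linear operators. *)
Definition is_operator (R : realType) (H K : hilbertType R)
    (T : set (H * K)) : Prop :=
  [/\ T 0,
      forall (a : R[i]) (p q : H * K), T p -> T q -> T (a *: p + q)
    & forall (f : H) (u v : K), T (f, u) -> T (f, v) -> u = v].

Definition opdom (R : realType) (H K : hilbertType R)
    (T : set (H * K)) : set H := [set f | exists u, T (f, u)].

(* The value T f, for f in the domain of T (and 0 otherwise). *)
Definition opapp (R : realType) (H K : hilbertType R)
    (T : set (H * K)) (f : H) : K := xget 0 [set u | T (f, u)].

(* The product S T. *)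
Definition opcomp (R : realType) (H K L : hilbertType R)
    (S : set (K * L)) (T : set (H * K)) : set (H * L) :=
  [set p | exists2 u, T (p.1, u) & S (u, p.2)].

Definition opscale (R : realType) (H K : hilbertType R) (a : R)
    (T : set (H * K)) : set (H * K) :=
  [set p | exists2 u, T (p.1, u) & p.2 = a%:C *: u].

Definition adj (R : realType) (H K : hilbertType R)
    (T : set (H * K)) : set (K * H) :=
  [set p | forall f u, T (f, u) -> inner u p.1 = inner f p.2].

Definition opclosure (R : realType) (H K : hilbertType R)
    (T : set (H * K)) : set (H * K) := closure T.

Definition closed_densely_defined (R : realType) (H K : hilbertType R)
    (T : set (H * K)) : Prop :=
  [/\ is_operator T, closed T & dense (opdom T)].

Definition symmetric_op (R : realType) (H : hilbertType R)
    (S : set (H * H)) : Prop :=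
  is_operator S /\
  forall f g, opdom S f -> opdom S g ->
    inner (opapp S f) g = inner f (opapp S g).

Definition selfadjoint (R : realType) (H : hilbertType R)
    (S : set (H * H)) : Prop :=
  [/\ is_operator S, dense (opdom S) & adj S = S].

Definition nonneg_op (R : realType) (H : hilbertType R)
    (S : set (H * H)) : Prop :=
  forall f, opdom S f -> 0 <= inner (opapp S f) f.

Definition nonneg_selfadjoint (R : realType) (H : hilbertType R)
    (S : set (H * H)) : Prop :=
  selfadjoint S /\ nonneg_op S.

Definition bounded_nonneg (R : realType) (K : hilbertType R)
    (X : set (K * K)) : Prop :=
  [/\ is_operator X, opdom X = setT,
      exists M : R, forall f, `|opapp X f| <= M%:C * `|f|
    & nonneg_op X].

Definition opnorm (R : realType) (H K : hilbertType R)
    (X : set (H * K)) : R :=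
  sup [set complex.Re `|opapp X f| | f in [set f : H | `|f| <= 1]].

(* The nonnegative selfadjoint square root of a (possibly unbounded)
   nonnegative selfadjoint operator. *)
Definition opsqrt (R : realType) (H : hilbertType R)
    (A : set (H * H)) : set (H * H) :=
  xget set0 [set S : set (H * H) | nonneg_selfadjoint S /\ opcomp S S = A].

(* T^* T <= a A in the form sense. *)
Definition adjsq_le (R : realType) (H K : hilbertType R)
    (T : set (H * K)) (a : R) (A : set (H * H)) : Prop :=
  [/\ nonneg_selfadjoint A,
      opdom (opsqrt A) `<=` opdom T
    & forall f, opdom (opsqrt A) f ->
        `|opapp T f| ^+ 2 <= a%:C * `|opapp (opsqrt A) f| ^+ 2].

(* a A <= b B^* B in the form sense. *)
Definition le_adjsq (R : realType) (H K : hilbertType R)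
    (a : R) (A : set (H * H)) (b : R) (B : set (H * K)) : Prop :=
  [/\ nonneg_selfadjoint A,
      opdom B `<=` opdom (opsqrt A)
    & forall f, opdom B f ->
        a%:C * `|opapp (opsqrt A) f| ^+ 2 <= b%:C * `|opapp B f| ^+ 2].

(* Main.v *)
Require Import Defs.
From HB Require Import structures.
From mathcomp Require Import all_boot all_order all_algebra sesquilinear complex.
From mathcomp Require Import all_classical all_reals all_analysis.
From mathcomp Require Import ring lra.

Set Implicit Arguments.
Unset Strict Implicit.
Unset Printing Implicit Defensive.

Import Order.TTheory GRing.Theory Num.Theory.
Import numFieldNormedType.Exports.

Local Open Scope classical_set_scope.
Local Open Scope ring_scope.
Local Open Scope complex_scope.

(** Write [C] for the closure of [X^{1/2} B] and [A] for the operator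
[B^* X^{1/2} C]. Since [X B] is contained in the closed operator [T], so is
[X^{1/2} C]; hence a limit [h] of values [X^{1/2} B f_n] with [f_n] tending
to [0] is killed by [X^{1/2}], and being in the closure of the range of
[X^{1/2}] it vanishes: [C] is an operator. Its adjoint is [B^* X^{1/2}], so
that [A = C^* C], which is nonnegative and selfadjoint by a theorem of von
Neumann; the domain of [A^{1/2}] is the domain of [C], and
[|A^{1/2} f| = |C f|] there. The inclusions of [T^* B] in [A] and of [A]
in [B^* T] are then direct. The form inequalities hold because [X^{1/2}] has
norm at most [lam^{1/2}], while [T f = X^{1/2} C f] on the domain of [C]
and [C f = X^{1/2} B f] on the domain of [B]. Finally [B^* T] is
contained in the adjoint of [T^* B], so that all the operators between
[T^* B] and [B^* T], among them [B^* X B], coincide when [T^* B] is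
selfadjoint.

The underlying theory is developed along the following lines.

- Everything is done with the real inner product [rdot], the real part of
[inner]; on complex subspaces it determines adjoints and symmetry ([adjP]).

- An approximate Riesz lemma ([approx_riesz]): for a nonnegative form [q] on a
subspace and a [q]-bounded functional [l], near minimizers of
[q p p - 2 l p] represent [l] up to a small error. Applied to a closed
graph it gives orthogonal projections, whence von Neumann's theorem
([nonneg_selfadjoint_adj_comp]) and the fact that the domain of [C^* C] is a
core of [C] ([adj_comp_core]).

- The square root of a bounded symmetric [W] with [|1 - W| <= 1] is
[1 - Y], where [Y] is the limit of [Y_{n+1} = (1 - W + Y_n^2) / 2]
([sqrt_exists]). With the bounded operator [Q = (1 + A)^-1], the root of an
unbounded [A] is the operator mapping [Q^{1/2} h] to [(1 - Q)^{1/2} h]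
([nonneg_selfadjoint_sqrt]). Two closed operators [C] and [D] with
[C^* C = D^* D] have the same domain and the same norms ([adj_comp_form]),
so that nothing depends on the choice of the root.

- The existence of [X] is an extension problem for the nonnegative relation
[S = {(B f, T f)}], which satisfies [|h|^2 <= mu (h, g)] for [(g, h)]
in [S]. The approximate Riesz lemma for the form of [S] produces a bounded
nonnegative everywhere defined extension ([bounded_nonneg_extension]). *)

(** * The real inner product *)

Section RealInnerProduct.
Variables (R : realType) (H : hilbertType R).
Implicit Types (u v w : H) (a : R) (z : R[i]).

(** The real part of the inner product, a real inner product on the same space.
*)
Definition rdot u v : R := complex.Re (inner u v).

(** The norm as a real number. *)
Definition nrm u : R := complex.Re `|u|.

Lemma nrmE u : `|u| = (nrm u)%:C.
Proof. by rewrite /nrm RRe_real// ger0_real. Qed.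

Lemma rdotC u v : rdot u v = rdot v u.
Proof. by rewrite /rdot hermC /= expr0 mul1r; case: (inner v u). Qed.

Lemma rdotDl u v w : rdot (u + v) w = rdot u w + rdot v w.
Proof. by rewrite /rdot linearDl raddfD. Qed.

Lemma rdotDr u v w : rdot u (v + w) = rdot u v + rdot u w.
Proof. by rewrite rdotC rdotDl !(rdotC u). Qed.

Lemma rdotNl u v : rdot (- u) v = - rdot u v.
Proof. by rewrite /rdot linearNl raddfN. Qed.

Lemma rdotNr u v : rdot u (- v) = - rdot u v.
Proof. by rewrite rdotC rdotNl rdotC. Qed.

Lemma rdot0l u : rdot 0 u = 0.
Proof. by rewrite /rdot linear0l. Qed.

Lemma rdot0r u : rdot u 0 = 0.
Proof. by rewrite rdotC rdot0l. Qed.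

Lemma rdotZl a u v : rdot (a%:C *: u) v = a * rdot u v.
Proof.
rewrite /rdot linearZl_LR /=; case: (inner u v) => x y /=.
by rewrite mul0r subr0.
Qed.

Lemma rdotZr a u v : rdot u (a%:C *: v) = a * rdot u v.
Proof. by rewrite rdotC rdotZl rdotC. Qed.

Lemma rdotil u v : rdot ('i%C *: u) v = - rdot u ('i%C *: v).
Proof.
rewrite (rdotC u) /rdot !linearZl_LR /= (hermC inner u v) /= expr0 mul1r.
case: (inner v u) => x y; rewrite /=; lra.
Qed.

(** The complex inner product is determined by the real one. *)
Lemma innerE u v : inner u v = (rdot u v) +i* (rdot u ('i%C *: v)).
Proof.
rewrite (rdotC u ('i%C *: v)) /rdot linearZl_LR /=.
rewrite (hermC inner u v) /= expr0 mul1r.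
case: (inner v u) => x y /=; congr (_ +i* _); lra.
Qed.

Lemma scale_complexE z u : z *: u = (complex.Re z)%:C *: u +
  (complex.Im z)%:C *: ('i%C *: u).
Proof. by rewrite {1}[z]complexE mulrC scalerDl scalerA. Qed.

(** Expands real inner products of real linear combinations; identities between
vectors are proved by testing them with [rdot_inj] and expanding. *)
Definition rdotE := (rdotDl, rdotDr, rdotNl, rdotNr, rdotZl, rdotZr,
  rdot0l, rdot0r).

Lemma rdot_nrm u : rdot u u = nrm u ^+ 2.
Proof. by rewrite /rdot inner_norm nrmE -rmorphXn. Qed.

Lemma nrm_ge0 u : 0 <= nrm u.
Proof. by rewrite -lecR -nrmE; exact: normr_ge0. Qed.

Lemma rdot_ge0 u : 0 <= rdot u u.
Proof. by rewrite rdot_nrm sqr_ge0. Qed.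

Lemma nrm_eq0 u : nrm u = 0 -> u = 0.
Proof. by move=> h; apply/eqP; rewrite -normr_eq0 nrmE h. Qed.

Lemma rdot_eq0 u : rdot u u = 0 -> u = 0.
Proof.
by rewrite rdot_nrm => /eqP; rewrite sqrf_eq0 => /eqP; exact: nrm_eq0.
Qed.

Lemma rdot_inj u v : (forall w, rdot u w = rdot v w) -> u = v.
Proof.
move=> h; apply/eqP; rewrite -subr_eq0; apply/eqP/rdot_eq0.
by rewrite {1}rdotDl rdotNl h subrr.
Qed.

Lemma nrm0 : nrm (0 : H) = 0.
Proof. by rewrite /nrm normr0. Qed.

Lemma nrmN u : nrm (- u) = nrm u.
Proof. by rewrite /nrm normrN. Qed.

Lemma nrmBC u v : nrm (u - v) = nrm (v - u).
Proof. by rewrite -nrmN opprB. Qed.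

Lemma nrmD u v : nrm (u + v) <= nrm u + nrm v.
Proof. by have := ler_normD u v; rewrite !nrmE -rmorphD lecR. Qed.

Lemma nrm_triangle v u w : nrm (u - w) <= nrm (u - v) + nrm (v - w).
Proof. by apply: le_trans (nrmD _ _); rewrite addrA subrK. Qed.

Lemma nrmZ z u : nrm (z *: u) = complex.Re `|z| * nrm u.
Proof.
rewrite /nrm normrZ (nrmE u); case: `|z| => x y /=.
by rewrite mulr0 subr0.
Qed.

Lemma nrmZr a u : 0 <= a -> nrm (a%:C *: u) = a * nrm u.
Proof. by move=> a0; rewrite nrmZ ger0_norm// lecR. Qed.

Lemma nrm_le_sqr a u : 0 <= a -> (nrm u <= a) = (rdot u u <= a ^+ 2).
Proof. by move=> a0; rewrite rdot_nrm ler_sqr ?nnegrE// nrm_ge0. Qed.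

Lemma cauchy_schwarz u v : `|rdot u v| <= nrm u * nrm v.
Proof.
have [v0|v0] := eqVneq (nrm v) 0.
  by rewrite (nrm_eq0 v0) rdot0r normr0 nrm0 mulr0.
have vp : 0 < nrm v by rewrite lt_def v0 nrm_ge0.
rewrite -ler_sqr ?nnegrE ?mulr_ge0 ?nrm_ge0//.
rewrite real_normK ?num_real// exprMn -!rdot_nrm.
have := rdot_ge0 ((rdot v v)%:C *: u - (rdot u v)%:C *: v).
rewrite !rdotE (rdotC v u) => h.
have : 0 < rdot v v by rewrite rdot_nrm exprn_gt0.
nra.
Qed.

Lemma rdot_le u v : rdot u v <= nrm u * nrm v.
Proof. exact: le_trans (ler_norm _) (cauchy_schwarz _ _). Qed.

Lemma le_small (x y c : R) : (forall e : R, 0 < e -> x <= y + c * e) -> x <= y.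
Proof.
move=> h; have c1 : 0 < `|c| + 1 by rewrite ltr_wpDl.
apply/ler_addgt0Pr => e e0; rewrite (le_trans (h _ (divr_gt0 e0 c1)))// lerD2l.
rewrite mulrCA ger_pMr// ler_pdivrMr// mul1r.
by rewrite (le_trans (ler_norm _))// lerDl.
Qed.

Lemma small_real_eq0 (x c : R) :
  (forall e : R, 0 < e -> `|x| <= c * e) -> x = 0.
Proof.
move=> h; apply/normr0_eq0/eqP; rewrite eq_le normr_ge0 andbT.
by apply: (@le_small _ _ c) => e /h; rewrite add0r.
Qed.

Lemma small_nrm_eq0 u (c : R) :
  (forall e : R, 0 < e -> nrm u <= c * e) -> u = 0.
Proof.
move=> h; apply/nrm_eq0/(@small_real_eq0 _ c) => e /h.
by rewrite ger0_norm// nrm_ge0.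
Qed.

(** Completeness, for families of approximations indexed by their precision. *)
Lemma complete_net (P : R -> set H) :
  (forall e : R, 0 < e -> exists u, P e u) ->
  (forall d e u v, P d u -> P e v -> nrm (u - v) <= d + e) ->
  exists l, forall e u, P e u -> nrm (l - u) <= e.
Proof.
move=> ex cau.
have /choice[s sP] : forall n : nat, exists u, P n.+1%:R^-1 u.
  by move=> n; apply: ex; rewrite invr_gt0.
have h (e : R) : 0 < e -> exists N, forall n, (N <= n)%N -> n.+1%:R^-1 < e.
  by move=> e0; have [N _ hN] := near_infty_natSinv_lt (PosNum e0); exists N.
have cs : cauchy (s @ \oo).
  apply/cauchy_exP => e; rewrite ltcE /= => /andP[/eqP ei e0].
  have [N hN] := h _ (divr_gt0 e0 (ltr0n _ 2)).
  exists (s N); exists N => // n /= Nn; rewrite -ball_normE /= nrmE.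
  rewrite ltcE /= ei eqxx /= (le_lt_trans (cau _ _ _ _ (sP N) (sP n)))//.
  by rewrite [ltRHS]splitr ltrD ?hN.
have [l sl] := (cvg_ex _).1 (cauchy_cvg _ cs).
exists l => e u Pu.
suff key (d : R) : 0 < d -> nrm (l - u) <= e + d by apply/ler_addgt0Pr.
move=> d0.
have [N hN] := h _ (divr_gt0 d0 (ltr0n _ 2)).
have d2 : (0 : R[i]) < (d / 2)%:C by rewrite ltcR divr_gt0.
move/cvgrPdist_lt : sl => /(_ _ d2)[M _ hM].
pose n := maxn N M.
have h1 : nrm (l - s n) < d / 2.
  by have := hM n (leq_maxr _ _); rewrite nrmE ltcR.
have := hN n (leq_maxl _ _).
have := cau _ _ _ _ (sP n) Pu.
have := nrm_triangle (s n) l u.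
move: (n.+1%:R^-1) => r; lra.
Qed.

End RealInnerProduct.

(** * Closures and dense subsets *)

Section Topology.
Variables (R : realType) (H K : hilbertType R).

(** A positive element of [R[i]] is a positive real. *)
Lemma pos_complex (e : R[i]) :
  0 < e -> e = (complex.Re e)%:C /\ 0 < complex.Re e.
Proof. by case: e => x y; rewrite ltcE /= => /andP[/eqP -> ->]. Qed.

Lemma closure_pairP (T : set (H * K)) f u : closure T (f, u) <->
  forall e : R, 0 < e -> exists g v, [/\ T (g, v), nrm (f - g) <= e
                                       & nrm (u - v) <= e].
Proof.
split=> [cl e e0|h U].
  have ec : (0 : R[i]) < e%:C by rewrite ltcR.
  have [[g v] [Tgv []]] := cl _ (nbhsx_ballx (f, u) _ ec).
  rewrite /= -!ball_normE /= !nrmE !ltcR => /ltW fg /ltW uv.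
  by exists g, v.
move=> /nbhs_ballP[e /= /pos_complex[-> e0]] he.
have [g [v [Tgv fg uv]]] := h _ (divr_gt0 e0 (ltr0n _ 2)).
exists (g, v); split => //; apply: he; split => /=.
  rewrite -ball_normE /= nrmE ltcR (le_lt_trans fg)//; lra.
rewrite -ball_normE /= nrmE ltcR (le_lt_trans uv)//; lra.
Qed.

Lemma denseP (D : set H) : dense D <->
  forall f (e : R), 0 < e -> exists2 g, D g & nrm (f - g) <= e.
Proof.
split=> [dD f e e0|h U [f Uf] oU].
  have ec : (0 : R[i]) < e%:C by rewrite ltcR.
  have [|g []] := dD (ball f e%:C) _ (ball_open _ _).
    by exists f; exact: ballxx.
  by rewrite -ball_normE /= nrmE ltcR => /ltW h Dg; exists g.
have := (nbhs_ballP _ _).1 (open_nbhs_nbhs (conj oU Uf)).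
move=> [e /= /pos_complex[-> e0]] he.
have [g Dg fg] := h f _ (divr_gt0 e0 (ltr0n _ 2)).
exists g; split => //; apply: he.
rewrite -ball_normE /= nrmE ltcR (le_lt_trans fg)//; lra.
Qed.

End Topology.

(** * Approximate Riesz representation and projections *)

Lemma discriminant_le (R : realType) (A B C : R) : 0 <= A ->
  (forall t, 0 <= A * t ^+ 2 + 2 * B * t + C) -> B ^+ 2 <= A * C.
Proof.
move=> A0 h; have [A00|A00] := eqVneq A 0.
  have [->|B0] := eqVneq B 0; first by rewrite A00; lra.
  (* at this t the linear expression takes the value -1 *)
  have := h (- (C + 1) / (2 * B)).
  rewrite A00 (_ : _ + C = -1); first lra.
  by field.
have := h (- B / A).
have -> : A * (- B / A) ^+ 2 + 2 * B * (- B / A) + C = (A * C - B ^+ 2) / A.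
  by field.
by rewrite pmulr_lge0 ?invr_gt0 ?lt_def ?A00// subr_ge0.
Qed.

(** Linear subspaces, given as sets; applied to graphs, linear relations. *)
Definition subspace (R : realType) (E : lmodType R[i]) (D : set E) : Prop :=
  D 0 /\ forall (a : R[i]) p r, D p -> D r -> D (a *: p + r).

(** Let [q] be a nonnegative symmetric form on [D] and [l] a functional such
that [l p ^ 2 <= c * q p p]. There is a [p] in [D] that represents [l]
up to [e] times the seminorm of [q]: any [p] minimizing
[q p p - 2 * l p] up to [e ^ 2]. *)
Lemma approx_riesz (R : realType) (E : lmodType R[i]) (D : set E)
    (q : E -> E -> R) (l : E -> R) (c : R) :
  subspace D ->
  (forall (a : R) p r s, q (a%:C *: p + r) s = a * q p s + q r s) ->
  (forall p r, D p -> D r -> q p r = q r p) ->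
  (forall p, D p -> 0 <= q p p) ->
  (forall (a : R) p r, l (a%:C *: p + r) = a * l p + l r) ->
  (forall p, D p -> l p ^+ 2 <= c * q p p) -> 0 <= c ->
  forall e : R, 0 < e ->
  exists2 p, D p & forall r, D r -> `|q r p - l r| <= e * Num.sqrt (q r r).
Proof.
move=> [D0 Dlin] qlin qC q0 llin lq c0 e e0.
pose F p := q p p - 2 * l p.
have hF : has_inf [set F p | p in D].
  split; first by exists (F 0), 0.
  exists (- c) => _ [p Dp <-]; rewrite /F.
  have := lq _ Dp; have := q0 _ Dp; set x := q p p; set y := l p => x0 yx.
  suff : - c <= x - 2 * y by [].
  have [y0|y0] := leP y 0; first lra.
  have : (2 * y) ^+ 2 <= (x + c) ^+ 2 by have := sqr_ge0 (x - c); lra.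
  by rewrite ler_sqr ?nnegrE; lra.
have [_ [p Dp <-] Fp] := inf_adherent (exprn_gt0 2 e0) hF.
exists p => // r Dr.
rewrite -ler_sqr ?nnegrE ?mulr_ge0 ?sqrtr_ge0 ?(ltW e0)//.
rewrite real_normK ?num_real// exprMn sqr_sqrtr ?q0// mulrC.
apply: discriminant_le; first exact: q0.
move=> t.
(* the minimized expression at t%:C *: r + p is at least its infimum *)
have Dt := Dlin t%:C _ _ Dr Dp.
have : inf [set F p | p in D] <= F (t%:C *: r + p).
  by apply: ge_inf; [case: hF | exists (t%:C *: r + p)].
move: Fp; rewrite /F qlin llin.
rewrite (qC r _ Dr Dt) (qC p _ Dp Dt) !qlin (qC p r) //.
nra.
Qed.

(** Any two approximate representatives are close in the seminorm of [q]. *)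
Lemma approx_riesz_cauchy (R : realType) (E : lmodType R[i]) (D : set E)
    (q : E -> E -> R) (l : E -> R) (d e : R) p r :
  subspace D ->
  (forall (a : R) p r s, q (a%:C *: p + r) s = a * q p s + q r s) ->
  (forall p r, D p -> D r -> q p r = q r p) ->
  (forall p, D p -> 0 <= q p p) -> 0 <= d -> 0 <= e -> D p -> D r ->
  (forall s, D s -> `|q s p - l s| <= d * Num.sqrt (q s s)) ->
  (forall s, D s -> `|q s r - l s| <= e * Num.sqrt (q s s)) ->
  Num.sqrt (q (p - r) (p - r)) <= d + e.
Proof.
move=> [_ Dlin] qlin qC q0 d0 e0 Dp Dr hp hr.
have pr : p - r = (-1)%:C *: r + p by rewrite rmorphN1 scaleN1r addrC.
have Ds : D (p - r) by rewrite pr; exact: Dlin.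
have := hp _ Ds; have := hr _ Ds.
have : q (p - r) p - q (p - r) r = Num.sqrt (q (p - r) (p - r)) ^+ 2.
  by rewrite sqr_sqrtr ?q0// {3}pr qlin !(qC (p - r))//; lra.
move: (sqrtr_ge0 (q (p - r) (p - r))); set t := Num.sqrt _ => t0 tE hr' hp'.
have : t ^+ 2 <= (d + e) * t by move: hp' hr'; rewrite -tE !ler_norml; lra.
have [->|tn0] := eqVneq t 0; first by rewrite addr_ge0.
by rewrite expr2 ler_pM2r// lt_def tn0.
Qed.

Section Projection.
Variables (R : realType) (H K : hilbertType R).

(** The projection of [(h, k)] on a closed subspace of the Hilbert sum. *)
Lemma projection (G : set (H * K)) (h : H) (k : K) :
  closed G -> subspace G ->
  exists f u, G (f, u) /\
    forall g v, G (g, v) -> rdot g (h - f) + rdot v (k - u) = 0.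
Proof.
move=> cG sG.
pose q (p r : H * K) := rdot p.1 r.1 + rdot p.2 r.2.
pose l (p : H * K) := rdot p.1 h + rdot p.2 k.
pose c := rdot h h + rdot k k.
have qlin (a : R) p r s : q (a%:C *: p + r) s = a * q p s + q r s.
  by rewrite /q /= !rdotE; lra.
have qC p r : q p r = q r p by rewrite /q !(rdotC r.1) !(rdotC r.2).
have q0 p : 0 <= q p p by rewrite addr_ge0 ?rdot_ge0.
pose ap (e : R) (p : H * K) := [/\ 0 < e, G p &
  forall r, G r -> `|q r p - l r| <= e * Num.sqrt (q r r)].
have ex e : 0 < e -> exists p, ap e p.
  move=> e0.
  have [|||p Gp Pp] := approx_riesz (l := l) (c := c) sG qlin
    (fun p r _ _ => qC p r) (fun p _ => q0 p) _ _ _ e0.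
  - by move=> a p r; rewrite /l /= !rdotE; lra.
  - move=> p _; rewrite mulrC; apply: discriminant_le => // t.
    have := rdot_ge0 (t%:C *: p.1 + h); have := rdot_ge0 (t%:C *: p.2 + k).
    by rewrite /q /l /c !rdotE (rdotC h p.1) (rdotC k p.2); lra.
  - by rewrite addr_ge0 ?rdot_ge0.
  by exists p.
have cau d e p r : ap d p -> ap e r -> q (p - r) (p - r) <= (d + e) ^+ 2.
  move=> [d0 Gp hp] [e0 Gr hr]; rewrite -[leLHS]sqr_sqrtr//.
  rewrite ler_sqr ?nnegrE ?sqrtr_ge0 ?addr_ge0 ?(ltW d0) ?(ltW e0)//.
  by apply: (approx_riesz_cauchy sG _ _ _ _ _ Gp Gr hp hr) => //; exact: ltW.
have [f hf] : exists f, forall e u, ap e u -> nrm (f - u.1) <= e.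
  have [| |f hf] := @complete_net R H (fun e f => exists2 p, ap e p & p.1 = f).
  - by move=> e /ex[p Pp]; exists p.1, p.
  - move=> d e _ _ [p Pp <-] [r Pr <-].
    have := cau _ _ _ _ Pp Pr; case: Pp Pr => [d0 _ _] [e0 _ _].
    rewrite nrm_le_sqr ?addr_ge0 ?(ltW d0) ?(ltW e0)//.
    by have := rdot_ge0 (p - r).2; rewrite /q /=; lra.
  by exists f => e u Pu; apply: hf; exists u.
have [u hu] : exists u, forall e p, ap e p -> nrm (u - p.2) <= e.
  have [| |u hu] := @complete_net R K (fun e f => exists2 p, ap e p & p.2 = f).
  - by move=> e /ex[p Pp]; exists p.2, p.
  - move=> d e _ _ [p Pp <-] [r Pr <-].
    have := cau _ _ _ _ Pp Pr; case: Pp Pr => [d0 _ _] [e0 _ _].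
    rewrite nrm_le_sqr ?addr_ge0 ?(ltW d0) ?(ltW e0)//.
    by have := rdot_ge0 (p - r).1; rewrite /q /=; lra.
  by exists u => e p Pp; apply: hu; exists p.
exists f, u; split.
  rewrite (closure_id G).1//; apply/closure_pairP => e e0.
  have [p Pp] := ex _ e0; exists p.1, p.2.
  by rewrite -surjective_pairing; split; [case: Pp|exact: hf|exact: hu].
move=> g v Ggv.
apply: (@small_real_eq0 _ _ (nrm g + nrm v + Num.sqrt (q (g, v) (g, v)))).
move=> e e0; have [p Pp] := ex _ e0.
have e0' := ltW e0.
have := cauchy_schwarz g (f - p.1); have := cauchy_schwarz v (u - p.2).
have := ler_wpM2l (nrm_ge0 g) (hf _ _ Pp).
have := ler_wpM2l (nrm_ge0 v) (hu _ _ Pp).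
have : `|q (g, v) p - l (g, v)| <= e * Num.sqrt (q (g, v) (g, v)).
  by case: Pp => _ _; exact.
have -> : rdot g (h - f) + rdot v (k - u) =
   - (q (g, v) p - l (g, v)) - (rdot g (f - p.1) + rdot v (u - p.2)).
  by rewrite /q /l !rdotE /=; lra.
rewrite !ler_norml; lra.
Qed.

Lemma closure_subspace (T : set (H * K)) : subspace T -> subspace (closure T).
Proof.
move=> [T0 Tlin]; split; first exact: subset_closure.
move=> a [f u] [g v] Tf Tg; apply/closure_pairP => e e0.
pose c : R := complex.Re `|a|.
have c0 : 0 <= c by rewrite -lecR RRe_real ?ger0_real//; exact: normr_ge0.
have d0 : 0 < e / (c + 1) by rewrite divr_gt0// ltr_wpDl.
have := (closure_pairP _ _ _).1 Tf _ d0 => -[f' [u' [Tf' ff' uu']]].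
have := (closure_pairP _ _ _).1 Tg _ d0 => -[g' [v' [Tg' gg' vv']]].
have h (L : hilbertType R) (x y x' y' : L) : nrm (x - x') <= e / (c + 1) ->
    nrm (y - y') <= e / (c + 1) -> nrm (a *: x + y - (a *: x' + y')) <= e.
  move=> hx hy; rewrite opprD addrACA -scalerBr.
  rewrite (le_trans (nrmD _ _))// nrmZ -/c.
  have := ler_wpM2l c0 hx.
  have : e = c * (e / (c + 1)) + e / (c + 1) by field; lra.
  move: (e / (c + 1)) hy => d; lra.
exists (a *: f' + g'), (a *: u' + v'); split; [|exact: h|exact: h].
exact: (Tlin a (f', u') (g', v')).
Qed.

End Projection.

(** A subspace with trivial orthogonal complement is dense. *)
Lemma dense_orth (R : realType) (H : hilbertType R) (D : set H) : subspace D ->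
  (forall h, (forall g, D g -> rdot g h = 0) -> h = 0) -> dense D.
Proof.
move=> [D0 Dlin] orth; pose T : set (H * H) := [set p | D p.1 /\ p.2 = 0].
have sT : subspace T.
  split=> // a p r [Dp p0] [Dr r0]; split; first exact: Dlin.
  by rewrite /= p0 r0 scaler0 addr0.
apply/denseP => f e e0.
have [g [v [Tg o]]] :=
  projection f 0 (@closed_closure _ T) (closure_subspace sT).
have [g' [v' [[Dg' _] gg' _]]] := (closure_pairP _ _ _).1 Tg _ e0.
exists g' => //; suff -> : f = g by [].
apply/eqP; rewrite -subr_eq0; apply/eqP/orth => k Dk.
have Tk : closure T (k, 0) by exact: subset_closure.
by have := o _ _ Tk; rewrite rdot0l addr0.
Qed.

(** * Graphs of operators and their adjoints *)

Section Operators.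
Variables (R : realType) (H K : hilbertType R).

Lemma operator_subspace (T : set (H * K)) : is_operator T -> subspace T.
Proof. by case. Qed.

Lemma opapp_eq (T : set (H * K)) f u :
  is_operator T -> T (f, u) -> opapp T f = u.
Proof.
move=> [_ _ fT] Tfu; rewrite /opapp; case: xgetP => [v _ Tfv|/(_ u)//].
exact: fT Tfv Tfu.
Qed.

Lemma opappP (T : set (H * K)) f : opdom T f -> T (f, opapp T f).
Proof. by move=> [u Tu]; rewrite /opapp; case: xgetP => [v _|/(_ u)]. Qed.

Lemma subspaceZ (T : set (H * K)) (a : R[i]) f u : subspace T -> T (f, u) ->
  T (a *: f, a *: u).
Proof.
by move=> [T0 Tl] Tfu; have := Tl a _ _ Tfu T0; rewrite addr0.
Qed.

Lemma subspaceD (T : set (H * K)) f u g v :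
  subspace T -> T (f, u) -> T (g, v) -> T (f + g, u + v).
Proof.
move=> [T0 Tl] Tfu Tgv; have := Tl 1 _ _ Tfu Tgv.
by rewrite scale1r.
Qed.

Lemma subspaceB (T : set (H * K)) f u g v :
  subspace T -> T (f, u) -> T (g, v) -> T (f - g, u - v).
Proof.
move=> sT Tfu Tgv; apply: subspaceD => //.
by rewrite -[- g]scaleN1r -[- v]scaleN1r; exact: subspaceZ.
Qed.

Lemma operatorP (T : set (H * K)) : subspace T ->
  (forall u, T (0, u) -> u = 0) -> is_operator T.
Proof.
move=> sT T0; split; [by case: sT|by case: sT|].
move=> f u v Tu Tv; apply/eqP; rewrite -subr_eq0; apply/eqP/T0.
by rewrite -(subrr f); exact: subspaceB.
Qed.

Lemma inner_eqP (L M : hilbertType R) (x y : L) (z w : M) :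
  inner x y = inner z w <->
  rdot x y = rdot z w /\ rdot ('i%C *: x) y = rdot ('i%C *: z) w.
Proof.
rewrite !innerE !rdotil; split=> [[-> ->]//|[-> /oppr_inj ->]//].
Qed.

(** On graphs closed under multiplication by the imaginary unit, the adjoint is
determined by the real inner product. *)
Lemma adjP (T : set (H * K)) k h : subspace T ->
  adj T (k, h) <-> forall f u, T (f, u) -> rdot u k = rdot f h.
Proof.
move=> sT; split=> [a f u /a /=/inner_eqP[]//|a f u Tfu].
by apply/inner_eqP; split; apply: a => //; exact: subspaceZ.
Qed.

Lemma adj_subspace (T : set (H * K)) : subspace T -> subspace (adj T).
Proof.
move=> sT; split; first by apply/(adjP _ _ sT) => f u _; rewrite !rdot0r.
move=> a [k h] [k' h'] Th Th' f u Tfu /=.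
by rewrite !linearDr !linearZr_LR /= (Th _ _ Tfu) (Th' _ _ Tfu).
Qed.

Lemma adj_closed (T : set (H * K)) : subspace T -> closed (adj T).
Proof.
move=> sT; apply/closure_id/seteqP; split; first exact: subset_closure.
move=> [k h] /(closure_pairP _ _ _).1 cl; apply/(adjP _ _ sT) => f u Tfu.
apply/eqP; rewrite -subr_eq0; apply/eqP.
apply: (@small_real_eq0 _ _ (nrm f + nrm u)) => e e0.
have [k' [h' [/(adjP _ _ sT)/(_ _ _ Tfu) a kk hh]]] := cl _ e0.
have := cauchy_schwarz u (k - k'); have := cauchy_schwarz f (h - h').
have := ler_wpM2l (nrm_ge0 f) hh; have := ler_wpM2l (nrm_ge0 u) kk.
have -> : rdot u k - rdot f h = rdot u (k - k') - rdot f (h - h').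
  by rewrite !rdotE; lra.
rewrite !ler_norml; lra.
Qed.

Lemma adj_closure (T : set (H * K)) : subspace T -> adj (closure T) = adj T.
Proof.
move=> sT; apply/seteqP; split=> [[k h] a f u Tf|[k h] /(adjP _ _ sT) a].
  by apply: a; exact: subset_closure.
apply/(adjP _ _ (closure_subspace sT)) => f u /(closure_pairP _ _ _).1 cl.
apply/eqP; rewrite -subr_eq0; apply/eqP.
apply: (@small_real_eq0 _ _ (nrm h + nrm k)) => e e0.
have [g [v [Tg fg uv]]] := cl _ e0.
have := cauchy_schwarz (u - v) k; have := cauchy_schwarz (f - g) h.
have := ler_wpM2r (nrm_ge0 h) fg; have := ler_wpM2r (nrm_ge0 k) uv.
have -> : rdot u k - rdot f h = rdot (u - v) k - rdot (f - g) h.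
  by rewrite !rdotE (a _ _ Tg); lra.
rewrite !ler_norml; lra.
Qed.

Lemma dense_orth0 (D : set H) h : dense D -> (forall f, D f -> rdot f h = 0) ->
  h = 0.
Proof.
move=> /denseP dD o; apply: (@small_nrm_eq0 _ _ _ 1) => e e0; rewrite mul1r.
have [g Dg hg] := dD h _ e0; apply: le_trans hg.
have [->|h0] := eqVneq h 0; first by rewrite nrm0 nrm_ge0.
have hp : 0 < nrm h.
  by rewrite lt_def nrm_ge0 andbT; apply: contra_neq h0; exact: nrm_eq0.
rewrite -(ler_pM2r hp) -expr2 -rdot_nrm (le_trans _ (rdot_le _ _))//.
by rewrite rdotDl rdotNl (o _ Dg) subr0.
Qed.

End Operators.

Section Adjoint.
Variables (R : realType) (H K : hilbertType R).

Lemma adj_operator (T : set (H * K)) : subspace T -> dense (opdom T) ->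
  is_operator (adj T).
Proof.
move=> sT dT; apply: operatorP; first exact: adj_subspace.
move=> h /(adjP _ _ sT) Th; apply: (dense_orth0 dT) => f [u /Th].
by rewrite rdot0r.
Qed.

Lemma operator_comp (L : hilbertType R) (S : set (K * L)) (T : set (H * K)) :
  is_operator S -> is_operator T -> is_operator (opcomp S T).
Proof.
move=> [S0 Sl Sf] [T0 Tl Tf]; split.
- by exists 0.
- move=> a [f w] [g x] [u Tu Su] [v Tv Sv]; exists (a *: u + v).
    exact: Tl a (f, u) (g, v) Tu Tv.
  exact: Sl a (u, w) (v, x) Su Sv.
- by move=> f w x [u /Tf Tu Su] [v /Tu uv Sv]; apply: Sf Su _; rewrite uv.
Qed.

End Adjoint.

(** * Von Neumann's theorem on C^* C *)

Section VonNeumann.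
Variables (R : realType) (H K : hilbertType R).

(** A positive symmetric operator [S] such that [1 + S] is onto is
selfadjoint; its domain need not be assumed dense. *)
Lemma selfadjointP (S : set (H * H)) : is_operator S ->
  (forall f u g v, S (f, u) -> S (g, v) -> rdot u g = rdot f v) ->
  (forall f u, S (f, u) -> 0 <= rdot u f) ->
  (forall h, exists f, S (f, h - f)) -> selfadjoint S.
Proof.
move=> oS symS posS onto; have sS := operator_subspace oS; split=> //.
  apply: dense_orth.
    split; first by exists 0; case: oS.
    move=> a f g [u Su] [v Sv]; exists (a *: u + v).
    by case: sS => _ /(_ a (f, u) (g, v)); exact.
  move=> z oz; have [f Sf] := onto z.
  have := oz f (ex_intro _ _ Sf); have := posS _ _ Sf.
  rewrite rdotDl rdotNl rdotC => h1 h2.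
  have f0 : f = 0 by apply/rdot_eq0/eqP; rewrite eq_le rdot_ge0 andbT; lra.
  by move: Sf; rewrite f0 subr0 => Sz; case: oS => S0 _ /(_ _ _ _ Sz S0).
apply/seteqP; split=> [[u w] /(adjP _ _ sS) Suw|[f u] Sf]; last first.
  by apply/(adjP _ _ sS) => g v Sg; rewrite (symS _ _ _ _ Sg Sf).
have [f Sf] := onto (u + w).
(* u - f is orthogonal to the range of 1 + S *)
have uf : u = f.
  apply/eqP; rewrite -subr_eq0; apply/eqP/rdot_eq0.
  have [g Sg] := onto (u - f).
  have := symS _ _ _ _ Sg Sf; have := Suw _ _ Sg.
  rewrite !rdotE; lra.
by move: Sf; rewrite -uf addrAC subrr add0r.
Qed.

Variable C : set (H * K).
Hypothesis hC : closed_densely_defined C.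

Let oC : is_operator C. Proof. by case: hC. Qed.
Let sC : subspace C. Proof. by case: oC. Qed.
Let cC : closed C. Proof. by case: hC. Qed.
Let dC : dense (opdom C). Proof. by case: hC. Qed.

(** The operator [1 + C^* C] is onto. *)
Lemma adj_comp_resolvent h : exists f u, C (f, u) /\ adj C (u, h - f).
Proof.
have [f [u [Cf o]]] := projection h 0 cC sC; exists f, u; split=> //.
by apply/(adjP _ _ sC) => g v /o; rewrite rdotDr !rdotDr !rdotNr rdot0r; lra.
Qed.

Lemma adj_comp_operator : is_operator (opcomp (adj C) C).
Proof. by apply: operator_comp => //; exact: adj_operator. Qed.

Lemma nonneg_selfadjoint_adj_comp : nonneg_selfadjoint (opcomp (adj C) C).
Proof.
have oA := adj_comp_operator; split.
  apply: selfadjointP => //.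
  - move=> f u g v [x Cx /(adjP _ _ sC) Dx] [y Cy /(adjP _ _ sC) Dy].
    have := Dx _ _ Cy; have := Dy _ _ Cx.
    by rewrite !(rdotC g) (rdotC y) => -> ->.
  - move=> f u [x Cx /(adjP _ _ sC) Dx].
    by rewrite rdotC -(Dx _ _ Cx) rdot_ge0.
  - move=> h; have [f [u [Cf Cu]]] := adj_comp_resolvent h.
    by exists f, u.
move=> f [u Af]; rewrite (opapp_eq oA Af); case: Af => x Cx Dx.
rewrite hermC /= expr0 mul1r -(Dx _ _ Cx) /= conjC_ge0.
by rewrite inner_norm exprn_ge0.
Qed.

(** The domain of [C^* C] is a core of [C]. *)
Lemma adj_comp_core f u (e : R) : 0 < e -> C (f, u) ->
  exists g v w,
    [/\ C (g, v), adj C (v, w), nrm (f - g) <= e & nrm (u - v) <= e].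
Proof.
move=> e0 Cf.
(* It suffices that the restriction of C to the domain of C^* C, of graph G, is
dense in C: the component of (f, u) orthogonal to the closure of G is zero. *)
pose G : set (H * K) := [set p | C p /\ exists w, adj C (p.2, w)].
have sG : subspace G.
  have [A0 Al] := adj_subspace sC.
  split; first by split; [case: sC|exists 0].
  move=> a p r [Cp [w Dp]] [Cr [x Dr]]; split; first by case: sC => _; exact.
  by exists (a *: w + x); exact: (Al a (p.2, w) (r.2, x)).
have [f' [u' [clG o]]] :=
  projection f u (@closed_closure _ G) (closure_subspace sG).
have Cf' : C (f', u').
  rewrite (closure_id C).1//; apply: closure_subset clG; by move=> p [].
have Cff := subspaceB sC Cf Cf'.
have [ff uu] : f - f' = 0 /\ u - u' = 0.
  have [g [v [Cg Dv]]] := adj_comp_resolvent (f - f').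
  have Gg : closure G (g, v).
    by apply: subset_closure; split=> //; exists (f - f' - g).
  have := o _ _ Gg; have := (adjP _ _ sC).1 Dv _ _ Cff.
  rewrite (rdotC v) => -> h.
  have f0 : f - f' = 0.
    by apply: rdot_eq0; move: h; rewrite (rdotC g) rdotDr rdotNr; lra.
  by split=> //; move: Cff; rewrite f0; case: oC => C0 _ fC /fC; exact.
have := (closure_pairP _ _ _).1 clG _ e0 => -[g [v [[Cg [w Dv]] fg uv]]].
exists g, v, w; split=> //.
  by rewrite (subr0_eq ff).
by rewrite (subr0_eq uu).
Qed.

End VonNeumann.

(** * Square roots of bounded operators *)

Section SquareRoot.
Variables (R : realType) (H : hilbertType R).

(** Everywhere defined linear and symmetric operators, as functions. *)
Definition linop (P : H -> H) :=
  forall (a : R[i]) u v, P (a *: u + v) = a *: P u + P v.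

Definition symop (P : H -> H) := forall u v, rdot (P u) v = rdot u (P v).

Section Linop.
Variables (P : H -> H).
Hypothesis lP : linop P.

Lemma linop0 : P 0 = 0.
Proof. by have := lP (-1) 0 0; rewrite !scaleN1r addr0 oppr0 addNr. Qed.

Lemma linopD u v : P (u + v) = P u + P v.
Proof. by have := lP 1 u v; rewrite !scale1r. Qed.

Lemma linopZ a u : P (a *: u) = a *: P u.
Proof. by have := lP a u 0; rewrite linop0 !addr0. Qed.

Lemma linopN u : P (- u) = - P u.
Proof. by rewrite -scaleN1r linopZ scaleN1r. Qed.

Lemma linopB u v : P (u - v) = P u - P v.
Proof. by rewrite linopD linopN. Qed.

End Linop.

(** The iteration for the square root of [W], when [1 - W] is a contraction. The
same iteration on numbers, [sqrt_bound], dominates it: both [Y n] and the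
increments of [Y] are bounded in norm by their numerical counterparts. *)
Section Iteration.
Variable W : H -> H.
Hypotheses (lW : linop W) (sW : symop W).
Hypothesis cW : forall f, nrm (f - W f) <= nrm f.

Fixpoint sqrt_iter (n : nat) (f : H) : H :=
  if n is m.+1 then
    (2^-1 : R)%:C *: (f - W f + sqrt_iter m (sqrt_iter m f))
  else 0.

Fixpoint sqrt_bound (n : nat) : R :=
  if n is m.+1 then 2^-1 * (1 + sqrt_bound m ^+ 2) else 0.

Local Notation Y := sqrt_iter.
Local Notation y := sqrt_bound.

Lemma sqrt_bound01 n : 0 <= y n <= 1.
Proof. elim: n => /= [|n]; nra. Qed.

Lemma sqrt_boundS n : y n <= y n.+1.
Proof. by have := sqr_ge0 (1 - y n); rewrite [y n.+1]/=; lra. Qed.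

Lemma sqrt_iter_lin n : linop (Y n).
Proof.
elim: n => [|n IH] a u v /=; first by rewrite scaler0 addr0.
rewrite lW !IH scalerA (mulrC a) -scalerA -scalerDr; congr (_ *: _).
by rewrite scalerDr scalerBr opprD (addrACA (a *: u)) (addrACA (a *: u - _)).
Qed.

Lemma sqrt_iter_sym n : symop (Y n).
Proof.
elim: n => [|n IH] u v /=; first by rewrite rdot0l rdot0r.
by rewrite !rdotE sW !IH.
Qed.

Lemma sqrt_iter_comm n (V : H -> H) :
  linop V -> (forall f, V (W f) = W (V f)) ->
  forall f, V (Y n f) = Y n (V f).
Proof.
move=> lV VW; elim: n => [|n IH] f /=; first by rewrite linop0.
by rewrite linopZ// linopD// linopB// VW !IH.
Qed.

Lemma sqrt_iter_bound n f : nrm (Y n f) <= y n * nrm f.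
Proof.
elim: n f => [|n IH] f /=; first by rewrite nrm0 mul0r.
rewrite nrmZr ?invr_ge0// -mulrA ler_wpM2l ?invr_ge0//.
have := nrmD (f - W f) (Y n (Y n f)); have := cW f.
have := IH (Y n f); have := IH f; have /andP[] := sqrt_bound01 n.
move: (nrm _) (nrm _) (nrm _) (nrm _) (nrm _) => a b c d x; nra.
Qed.

Lemma sqrt_iterS n f : nrm (Y n.+1 f - Y n f) <= (y n.+1 - y n) * nrm f.
Proof.
elim: n f => [|n IH] f; first by rewrite [y 0]/= !subr0; exact: sqrt_iter_bound.
have -> : Y n.+2 f - Y n.+1 f = (2^-1 : R)%:C *:
    (Y n.+1 (Y n.+1 f - Y n f) + (Y n.+1 (Y n f) - Y n (Y n f))).
  rewrite (linopB (sqrt_iter_lin n.+1)).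
  by rewrite addrA subrK -scalerBr opprD addrACA subrr add0r.
have -> : y n.+2 - y n.+1 = 2^-1 * (y n.+1 ^+ 2 - y n ^+ 2) by rewrite /=; lra.
rewrite nrmZr ?invr_ge0// -mulrA ler_wpM2l ?invr_ge0//.
apply: le_trans (nrmD _ _) _.
have := sqrt_iter_bound n.+1 (Y n.+1 f - Y n f); have := IH (Y n f).
have := IH f; have := sqrt_iter_bound n f.
have /andP[] := sqrt_bound01 n.+1; have := sqrt_boundS n.
have /andP[] := sqrt_bound01 n.
move: (y n) (y n.+1) (nrm _) (nrm _) (nrm _) (nrm _) (nrm _) => a b c d e g h.
nra.
Qed.

Lemma sqrt_iter_cauchy m n f : (m <= n)%N ->
  nrm (Y n f - Y m f) <= (y n - y m) * nrm f.
Proof.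
move=> /subnK <-; elim: (n - m)%N => [|k IH].
  by rewrite add0n !subrr nrm0 mul0r.
rewrite addSn (le_trans (nrm_triangle (Y (k + m) f) _ _))//.
have := sqrt_iterS (k + m) f; rewrite -/(y _) -/(Y _); lra.
Qed.

Let s := sup (range y).

Let y_le n : y n <= s.
Proof.
apply: ub_le_sup; last by exists n.
by exists 1 => _ [m _ <-]; case/andP: (sqrt_bound01 m).
Qed.

Let s_le1 : s <= 1.
Proof.
apply: ge_sup; first by exists (y 0), 0.
by move=> _ [m _ <-]; case/andP: (sqrt_bound01 m).
Qed.

Let gap (e : R) : 0 < e -> exists n, s - y n <= e.
Proof.
move=> e0; have [|_ [n _ <-] h] := @sup_adherent _ (range y) _ e0.
  split; first by exists (y 0), 0.
  by exists 1 => _ [m _ <-]; case/andP: (sqrt_bound01 m).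
by exists n; rewrite lerBlDr addrC -lerBlDr ltW.
Qed.

Let vanish (c : R) (u : H) :
  0 <= c -> (forall n, nrm u <= (s - y n) * c) -> u = 0.
Proof.
move=> c0 h; apply: (@small_nrm_eq0 _ _ _ c) => e /gap[n hn].
by rewrite (le_trans (h n))// mulrC ler_wpM2l.
Qed.

Let vanishr (c x : R) :
  0 <= c -> (forall n, `|x| <= (s - y n) * c) -> x = 0.
Proof.
move=> c0 h; apply: (@small_real_eq0 _ _ c) => e /gap[n hn].
by rewrite (le_trans (h n))// mulrC ler_wpM2l.
Qed.

Let limit f : exists l, forall n, nrm (l - Y n f) <= (s - y n) * nrm f.
Proof.
(* Y n f is within (s - y n) * nrm f of the limit *)
pose P (e : R) v := exists2 n, v = Y n f & (s - y n) * nrm f <= e.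
have [e e0||l hl] := @complete_net _ _ P.
- have d0 : 0 < e / (nrm f + 1) by rewrite divr_gt0// ltr_wpDl// nrm_ge0.
  have [n hn] := gap d0; exists (Y n f), n => //.
  rewrite (le_trans (ler_wpM2r (nrm_ge0 f) hn))// mulrAC ler_pdivrMr.
    by rewrite ler_pM2l// lerDl.
  by rewrite ltr_wpDl// nrm_ge0.
- move=> d e _ _ [m -> md] [n -> ne].
  apply: le_trans (lerD md ne).
  have f0 := nrm_ge0 f; have ym := y_le m; have yn := y_le n.
  have [/sqrt_iter_cauchy-/(_ f) h|/ltnW/sqrt_iter_cauchy-/(_ f) h] := leqP m n.
    by rewrite nrmBC (le_trans h)// -mulrDl ler_wpM2r//; lra.
  by rewrite (le_trans h)// -mulrDl ler_wpM2r//; lra.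
by exists l => n; apply: hl; exists n.
Qed.

(** The bounded square root of a symmetric [W] such that [1 - W] is a
contraction, which is then nonnegative. Commuting with [P] is only stated for
symmetric [V], for which no continuity assumption is needed. *)
Lemma sqrt_exists : exists P : H -> H,
  [/\ linop P, symop P, forall f, P (P f) = W f,
      forall f, nrm (f - P f) <= nrm f
    & forall V, linop V -> symop V -> (forall f, V (W f) = W (V f)) ->
        forall f, V (P f) = P (V f)].
Proof.
have [L hL] := choice limit.
have uniq l f c :
    0 <= c -> (forall n, nrm (l - Y n f) <= (s - y n) * c) -> l = L f.
  move=> c0 hl; apply/eqP; rewrite -subr_eq0; apply/eqP.
  apply: (@vanish (c + nrm f)) => [|n]; first by rewrite addr_ge0 ?nrm_ge0.
  rewrite (le_trans (nrm_triangle (Y n f) _ _))// mulrDr lerD//.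
  by rewrite nrmBC.
have s_ge n : 0 <= s - y n by rewrite subr_ge0.
have lL : linop L.
  move=> a u v; apply/esym/(@uniq _ _ (complex.Re `|a| * nrm u + nrm v)).
    rewrite addr_ge0 ?nrm_ge0// mulr_ge0 ?nrm_ge0//.
    by rewrite -lecR RRe_real ?ger0_real//; exact: normr_ge0.
  move=> n; rewrite sqrt_iter_lin opprD addrACA -scalerBr.
  rewrite (le_trans (nrmD _ _))// nrmZ mulrDr mulrCA lerD// ler_wpM2l//.
  by rewrite -lecR RRe_real ?ger0_real//; exact: normr_ge0.
have bL f : nrm (L f) <= nrm f.
  rewrite -[L f](subrK (Y 0 f)) (le_trans (nrmD _ _))// nrm0 addr0.
  by rewrite (le_trans (hL f 0))// ler_piMl ?nrm_ge0//= subr0.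
(* the fixed point equation, which says that (1 - L)^2 = W *)
have eL f : L f = (2^-1 : R)%:C *: (f - W f + L (L f)).
  apply/eqP; rewrite -subr_eq0; apply/eqP.
  apply: (@vanish (nrm f + (nrm f + nrm f))) => [|n].
    by rewrite !addr_ge0 ?nrm_ge0.
  rewrite (le_trans (nrm_triangle (Y n.+1 f) _ _))// mulrDr lerD//.
    rewrite (le_trans (hL _ _))// ler_wpM2r ?nrm_ge0//.
    by have := sqrt_boundS n; lra.
  rewrite /= -scalerBr opprD addrACA subrr add0r nrmZr ?invr_ge0//.
  have : nrm (Y n (Y n f) - L (L f)) <= (s - y n) * (nrm f + nrm f).
    rewrite nrmBC (le_trans (nrm_triangle (Y n (L f)) _ _))// mulrDr lerD//.
      by rewrite (le_trans (hL _ _))// ler_wpM2l.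
    rewrite -(linopB (sqrt_iter_lin n)) (le_trans (sqrt_iter_bound _ _))//.
    rewrite (le_trans _ (hL f n))// ler_piMl ?nrm_ge0//.
    by case/andP: (sqrt_bound01 n).
  have := nrm_ge0 (Y n (Y n f) - L (L f)); lra.
have sL : symop L.
  move=> u v; apply/eqP; rewrite -subr_eq0; apply/eqP.
  apply: (@vanishr (nrm u * nrm v + nrm u * nrm v)) => [|n].
    by rewrite addr_ge0 ?mulr_ge0 ?nrm_ge0.
  have -> : rdot (L u) v - rdot u (L v) =
      rdot (L u - Y n u) v - rdot u (L v - Y n v).
    by rewrite !rdotE sqrt_iter_sym; lra.
  rewrite (le_trans (ler_normB _ _))// mulrDr lerD//.
    by rewrite (le_trans (cauchy_schwarz _ _))// mulrA ler_wpM2r ?nrm_ge0.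
  by rewrite (le_trans (cauchy_schwarz _ _))// mulrCA ler_wpM2l ?nrm_ge0.
have cL V : linop V -> symop V -> (forall f, V (W f) = W (V f)) ->
    forall f, V (L f) = L (V f).
  move=> lV sV VW f; apply: rdot_inj => g.
  apply/eqP; rewrite -subr_eq0; apply/eqP.
  apply: (@vanishr (nrm f * nrm (V g) + nrm (V f) * nrm g)) => [|n].
    by rewrite addr_ge0 ?mulr_ge0 ?nrm_ge0.
  have -> : rdot (V (L f)) g - rdot (L (V f)) g =
      rdot (L f - Y n f) (V g) - rdot (L (V f) - Y n (V f)) g.
    by rewrite !rdotE -sqrt_iter_comm// !sV; lra.
  rewrite (le_trans (ler_normB _ _))// mulrDr !mulrA lerD//.
    by rewrite (le_trans (cauchy_schwarz _ _))// ler_wpM2r ?nrm_ge0.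
  by rewrite (le_trans (cauchy_schwarz _ _))// ler_wpM2r ?nrm_ge0.
exists (fun f => f - L f); split.
- by move=> a u v; rewrite lL opprD addrACA scalerBr.
- by move=> u v; rewrite !rdotE sL.
- move=> f; rewrite (linopB lL); apply: rdot_inj => g.
  have := congr1 (fun x => rdot x g) (eL f); rewrite !rdotE; lra.
- by move=> f; rewrite opprB addrC subrK bL.
- by move=> V lV sV VW f; rewrite (linopB lV) cL.
Qed.

End Iteration.
End SquareRoot.

(** * Square roots of unbounded operators *)

Section OperatorSquareRoot.
Variables (R : realType) (H : hilbertType R).

Lemma selfadjoint_sym (S : set (H * H)) f u g v : selfadjoint S ->
  S (f, u) -> S (g, v) -> rdot u g = rdot f v.
Proof.
move=> [oS _ aS] Sf; rewrite -{1}aS.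
by move=> /(adjP _ _ (operator_subspace oS)); exact.
Qed.

(** For a symmetric operator the imaginary part of [(S f, f)] is zero, so that
nonnegativity is a property of the real inner product. *)
Lemma nonneg_opP (S : set (H * H)) : is_operator S ->
  (forall f u g v, S (f, u) -> S (g, v) -> rdot u g = rdot f v) ->
  nonneg_op S <-> forall f u, S (f, u) -> 0 <= rdot u f.
Proof.
move=> oS symS; split=> [pS f u Sf|pS f /opappP Sf].
  have /pS : opdom S f by exists u.
  by rewrite (opapp_eq oS Sf) innerE lecE => /andP[].
rewrite innerE lecE /= pS// andbT.
have Sif := subspaceZ 'i%C (operator_subspace oS) Sf.
have := symS _ _ _ _ Sf Sif; have := rdotil (opapp S f) f.
by rewrite (rdotC f) => -> h; apply/eqP; lra.
Qed.

(** If [1 + A] is onto, then [A] has a nonnegative selfadjoint square root: with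
[Q] the inverse of [1 + A], [P = Q^{1/2}] and [N = (1 - Q)^{1/2}], it is the
operator mapping [P h] to [N h]. *)
Lemma nonneg_selfadjoint_sqrt (A : set (H * H)) : nonneg_selfadjoint A ->
  (forall h, exists f, A (f, h - f)) ->
  exists S, nonneg_selfadjoint S /\ opcomp S S = A.
Proof.
move=> [sA nA] /choice[Q hQ].
have oA : is_operator A by case: sA.
have symA f u g v := @selfadjoint_sym A f u g v sA.
have posA := (nonneg_opP oA symA).1 nA.
have uniq f h : A (f, h - f) -> f = Q h.
  move=> Af; have := posA _ _ (subspaceB (operator_subspace oA) Af (hQ h)).
  rewrite opprB (addrC (h - f)) addrA subrK => d0; apply/eqP; rewrite -subr_eq0.
  apply/eqP/rdot_eq0/eqP; rewrite eq_le rdot_ge0 andbT.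
  by move: d0; rewrite -opprB rdotNl; lra.
have lQ : linop Q.
  move=> a u v; apply/esym/uniq.
  rewrite opprD addrACA -scalerBr.
  by case: oA => _ /(_ a (Q u, u - Q u) (Q v, v - Q v)) + _; exact.
have symQ : symop Q.
  move=> u v; have := symA _ _ _ _ (hQ u) (hQ v); rewrite !rdotE; lra.
have cN f : nrm (f - Q f) <= nrm f.
  rewrite nrm_le_sqr ?nrm_ge0// -rdot_nrm.
  have := posA _ _ (hQ f); have := rdot_ge0 (Q f).
  by rewrite !rdotE (rdotC (Q f) f); lra.
have cQ f : nrm (f - (f - Q f)) <= nrm f.
  rewrite nrm_le_sqr ?nrm_ge0// -rdot_nrm subKr.
  have := posA _ _ (hQ f); have := rdot_ge0 (f - Q f).
  by rewrite !rdotE (rdotC (Q f) f); lra.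
have [P [lP sP PP cP _]] := sqrt_exists lQ symQ cN.
have lQ' : linop (fun f => f - Q f).
  by move=> a u v; rewrite lQ opprD addrACA scalerBr.
have sQ' : symop (fun f => f - Q f) by move=> u v; rewrite !rdotE symQ.
have [N [lN sN NN cN' commN]] := sqrt_exists lQ' sQ' cQ.
have PN f : P (N f) = N (P f).
  by apply: commN => // g; rewrite (linopB lP) -!PP.
(* the square root of P, which commutes with N; it shows that P N >= 0 *)
have [P1 [lP1 sP1 PP1 _ commP1]] := sqrt_exists lP sP cP.
have posN f : 0 <= rdot (N f) f.
  have := rdot_le (f - N f) f; have := ler_wpM2r (nrm_ge0 f) (cN' f).
  rewrite rdotDl rdotNl rdot_nrm; lra.
have P_inj h : P h = 0 -> h = 0.
  move=> Ph; have Qh : Q h = 0 by rewrite -PP Ph (linop0 lP).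
  by have := hQ h; rewrite Qh subr0; case: oA => A0 _ fA /fA; exact.
pose S : set (H * H) := [set p | exists h, p = (P h, N h)].
have oS : is_operator S.
  split.
  - by exists 0; rewrite (linop0 lP) (linop0 lN).
  - by move=> a _ _ [h ->] [k ->]; exists (a *: h + k); rewrite lP lN.
  - move=> f u v [h [-> ->]] [k [hk ->]]; suff -> : h = k by [].
    apply/eqP; rewrite -subr_eq0; apply/eqP/P_inj.
    by rewrite (linopB lP) hk subrr.
have symS f u g v : S (f, u) -> S (g, v) -> rdot u g = rdot f v.
  by move=> [h [-> ->]] [k [-> ->]]; rewrite sN -PN sP.
exists S; split; first split.
- split=> //.
    apply: dense_orth.
      split; first by exists 0, 0; rewrite (linop0 lP) (linop0 lN).
      move=> a _ _ [_ [h [-> _]]] [_ [k [-> _]]].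
      by exists (N (a *: h + k)), (a *: h + k); rewrite lP.
    move=> h oh; apply: P_inj; apply: rdot_inj => w.
    by rewrite rdot0l sP rdotC; apply: oh; exists (N w), w.
  apply/seteqP; split=> [[u v] /(adjP _ _ (operator_subspace oS)) Suv|].
    have NP : N u = P v.
      apply: rdot_inj => w; rewrite sN sP rdotC (rdotC v).
      by apply: Suv; exists w.
    (* the preimage, since P^2 + N^2 = 1 *)
    exists (P u + N v); rewrite (linopD lP) (linopD lN) PP NN -PN NP PN.
    by rewrite -NP NN addrC subrK NP PP addrC subrK.
  move=> [f u] Sf; apply/(adjP _ _ (operator_subspace oS)) => g v Sg.
  exact: symS Sg Sf.
- apply/(nonneg_opP oS symS) => _ _ [h [-> ->]].
  by rewrite rdotC sP -PP1 -sP1 -(commP1 N)// rdotC.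
- apply/seteqP; split=> [[f w] [u [h [-> ->]] [k [NP ->]]]|[f w] Af].
    have hk : h = P (P h + N k).
      by rewrite (linopD lP) PP PN -NP NN addrC subrK.
    have kk : k = N (P h + N k).
      apply/eqP; rewrite -subr_eq0; apply/eqP/P_inj; rewrite (linopB lP).
      by rewrite -NP PN -hk subrr.
    have /= := hQ (P h + N k).
    by rewrite -PP -hk addrC addKr.
  have fE : f = Q (f + w) by apply: uniq; rewrite addrC addKr.
  have -> : w = (f + w) - Q (f + w) by rewrite -fE addrC addKr.
  move: (f + w) fE => g ->; exists (N (P g)); first by exists (P g); rewrite PP.
  by exists (N g); rewrite NN PN.
Qed.

End OperatorSquareRoot.

(** * The form domain of C^* C *)

Section FormDomain.
Variables (R : realType) (H : hilbertType R).

(** If [C^* C = D^* D], the norms of [C] and [D] agree on the domain of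
this operator, which is a core of [C]; as [D] is closed, its domain contains
the domain of [C], and the norms agree there. *)
Lemma adj_comp_form (K L : hilbertType R)
    (C : set (H * K)) (D : set (H * L)) f u :
  closed_densely_defined C -> closed_densely_defined D ->
  opcomp (adj C) C = opcomp (adj D) D -> C (f, u) ->
  exists2 w, D (f, w) & nrm w = nrm u.
Proof.
move=> hC [oD cD _] CD Cf.
have sC : subspace C by case: hC => -[].
have sD := operator_subspace oD.
have sA := adj_subspace sC.
have form (g : H) v w x : C (g, v) -> adj C (v, w) -> D (g, x) -> nrm x = nrm v.
  move=> Cg Av Dg.
  have : opcomp (adj D) D (g, w) by rewrite -CD; exists v.
  case=> x' /=; case: (oD) => _ _ fD /fD/(_ Dg) -> /(adjP _ _ sD)/(_ _ _ Dg) h.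
  apply/eqP; rewrite -(@eqrXn2 _ 2) ?nrm_ge0// -!rdot_nrm h.
  by rewrite ((adjP _ _ sC).1 Av _ _ Cg).
have domD (g : H) v w : C (g, v) -> adj C (v, w) -> exists x, D (g, x).
  move=> Cg Av; have : opcomp (adj D) D (g, w) by rewrite -CD; exists v.
  by case=> x Dg _; exists x.
pose ap (e : R) (x : L) := exists g v w, [/\ C (g, v), adj C (v, w), D (g, x),
  nrm (f - g) <= e & nrm (u - v) <= e].
have ex e : 0 < e -> exists x, ap e x.
  move=> e0; have [g [v [w [Cg Av fg uv]]]] := adj_comp_core hC e0 Cf.
  by have [x Dg] := domD _ _ _ Cg Av; exists x, g, v, w.
have [//|d e x y [g [v [w [Cg Av Dg fg uv]]]]|x hx] := @complete_net _ _ ap.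
  move=> [g' [v' [w' [Cg' Av' Dg' fg' uv']]]].
  rewrite (form (g - g') (v - v') (w - w')); first last.
  - exact: subspaceB.
  - exact: (subspaceB sA).
  - exact: subspaceB.
  rewrite (le_trans (nrm_triangle u _ _))// lerD//.
  by rewrite nrmBC.
exists x.
  rewrite (closure_id D).1//; apply/closure_pairP => e e0.
  have [y apy] := ex _ e0; have xy := hx _ _ apy.
  by case: apy => g [v [w [_ _ Dg fg _]]]; exists g, y.
apply/eqP; rewrite -subr_eq0; apply/eqP.
apply: (@small_real_eq0 _ _ 2) => e e0.
have [y apy] := ex _ e0; have xy := hx _ _ apy.
case: apy => g [v [w [Cg Av Dg fg uv]]]; have := form _ _ _ _ Cg Av Dg.
have := nrmD (x - y) y; have := nrmD (y - x) x; rewrite !subrK.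
have := nrmD (u - v) v; have := nrmD (v - u) u; rewrite !subrK.
rewrite ler_norml (nrmBC v) (nrmBC y); lra.
Qed.

Lemma selfadjoint_closed (S : set (H * H)) : selfadjoint S ->
  closed_densely_defined S.
Proof.
move=> [oS dS aS]; split=> //; rewrite -aS.
exact: adj_closed (operator_subspace oS).
Qed.

Lemma opsqrtP (A : set (H * H)) :
  (exists S, nonneg_selfadjoint S /\ opcomp S S = A) ->
  nonneg_selfadjoint (opsqrt A) /\ opcomp (opsqrt A) (opsqrt A) = A.
Proof.
move=> [S hS]; rewrite /opsqrt; case: xgetP => [T _ //|/(_ S)/(_ hS)[]].
Qed.

(** [C] and the square root of [C^* C] have the same domain and the same
norms. *)
Lemma opsqrt_adj_comp (K : hilbertType R) (C : set (H * K)) :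
  closed_densely_defined C ->
  let S := opsqrt (opcomp (adj C) C) in
  [/\ is_operator S,
      forall f u, C (f, u) -> exists2 w, S (f, w) & nrm w = nrm u
    & forall f w, S (f, w) -> exists2 u, C (f, u) & nrm u = nrm w].
Proof.
move=> hC S.
have [[sS _] SS] : nonneg_selfadjoint S /\ opcomp S S = opcomp (adj C) C.
  apply/opsqrtP/nonneg_selfadjoint_sqrt.
    exact: nonneg_selfadjoint_adj_comp.
  move=> h; have [f [u [Cf Cu]]] := adj_comp_resolvent hC h.
  by exists f, u.
have hS := selfadjoint_closed sS.
have E : opcomp (adj C) C = opcomp (adj S) S by case: sS => _ _ ->.
split; first by case: sS.
  by move=> f u; exact: adj_comp_form.
by move=> f u; exact: adj_comp_form.
Qed.

End FormDomain.

(** * Bounded nonnegative operators *)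

Section Bounded.
Variables (R : realType) (K : hilbertType R).

(** The graph of an everywhere defined function. *)
Definition fgraph (x : K -> K) : set (K * K) := [set p | p.2 = x p.1].

Lemma fgraphE x f u : fgraph x (f, u) = (u = x f).
Proof. by []. Qed.

Lemma fgraph_operator x : linop x -> is_operator (fgraph x).
Proof.
move=> lx; split; first by rewrite /fgraph /= linop0.
  by move=> a [f u] [g v]; rewrite /fgraph /= => -> ->; rewrite lx.
by move=> f u v; rewrite /fgraph /= => -> ->.
Qed.

Lemma fgraph_selfadjoint x : linop x -> symop x -> selfadjoint (fgraph x).
Proof.
move=> lx sx; have ox := fgraph_operator lx; split=> //.
  apply/denseP => f e e0; exists f; first by exists (x f).
  by rewrite subrr nrm0 ltW.
apply/seteqP; split=> [[u w] /(adjP _ _ (operator_subspace ox)) a|[u w]].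
  apply: rdot_inj => g; rewrite sx rdotC -(a g (x g))//.
  exact: rdotC.
rewrite /fgraph /= => ->; apply/(adjP _ _ (operator_subspace ox)) => f v.
rewrite fgraphE => ->.
exact: sx.
Qed.

Lemma everywhereE (X : set (K * K)) : is_operator X -> opdom X = setT ->
  X = fgraph (opapp X) /\ linop (opapp X).
Proof.
move=> oX dX; have XP f : X (f, opapp X f) by apply: opappP; rewrite dX.
have XE : X = fgraph (opapp X).
  apply/seteqP; split=> [[f u] Xf|[f u]]; rewrite fgraphE.
    by rewrite (opapp_eq oX Xf).
  by move=> ->; exact: XP.
split=> // a u v; apply: opapp_eq => //.
by case: oX => _ /(_ a _ _ (XP u) (XP v)).
Qed.

(** Polarization: a nonnegative linear relation is symmetric. *)
Lemma nonneg_sym (S : set (K * K)) : subspace S ->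
  (forall f u, S (f, u) -> 0 <= inner u f) ->
  forall f u g v, S (f, u) -> S (g, v) -> rdot u g = rdot f v.
Proof.
move=> sS pS f u g v Sf Sg.
have im h w : S (h, w) -> rdot w ('i%C *: h) = 0.
  by move=> /pS; rewrite innerE lecE /= => /andP[/eqP].
have ii (x y : K) : rdot ('i%C *: x) ('i%C *: y) = rdot x y.
  by rewrite rdotil scalerA -expr2 sqr_i scaleN1r rdotNr opprK.
(* the form is real at (f, u) - i (g, v) *)
have := im _ _ (subspaceB sS Sf (subspaceZ 'i%C sS Sg)).
rewrite scalerBr scalerA -expr2 sqr_i scaleN1r opprK.
have := im _ _ Sf; have := im _ _ Sg.
by rewrite !rdotE ii (rdotil v g) (rdotC f); lra.
Qed.

(** A nonnegative operator of norm at most [M] satisfies [X^2 <= M X]. *)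
Lemma nonneg_sqr_le (x : K -> K) (M : R) : linop x -> symop x ->
  (forall f, 0 <= rdot (x f) f) ->
  0 < M -> (forall f, nrm (x f) <= M * nrm f) ->
  forall f, rdot (x f) (x f) <= M * rdot (x f) f.
Proof.
move=> lx sx px M0 bx f.
(* expand the inequality (X k, k) >= 0 at k = f - M^-1 X f *)
have := px (f - (M^-1)%:C *: x f).
rewrite (linopB lx) (linopZ lx) !rdotE.
have -> : rdot (x (x f)) f = rdot (x f) (x f) by rewrite sx.
have h : rdot (x (x f)) (x f) <= M * rdot (x f) (x f).
  rewrite (le_trans (rdot_le _ _))// rdot_nrm expr2 mulrA ler_wpM2r ?nrm_ge0//.
move: (rdot (x (x f)) (x f)) (rdot (x f) (x f)) (rdot (x f) f) h => a b c h h1.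
have Mi : 0 < M^-1 by rewrite invr_gt0.
have : M^-1 * (M^-1 * a) <= M^-1 * b.
  rewrite ler_pM2l// -[leRHS]mul1r -(mulVf (lt0r_neq0 M0)) -mulrA ler_pM2l//.
move=> h2.
have h3 : M^-1 * b <= c by lra.
by rewrite -ler_pdivrMl// .
Qed.

Lemma bounded_nonnegP (X : set (K * K)) : bounded_nonneg X ->
  [/\ X = fgraph (opapp X), linop (opapp X), symop (opapp X),
      forall f, 0 <= rdot (opapp X f) f
    & exists2 M : R, 0 < M & forall f, nrm (opapp X f) <= M * nrm f].
Proof.
move=> [oX dX [M hM] pX].
have [XE lX] := everywhereE oX dX.
have pX' f : 0 <= inner (opapp X f) f by apply: pX; rewrite dX.
split=> //.
    move=> f g; apply: (nonneg_sym (operator_subspace oX)).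
    - by move=> h w Xh; rewrite -(opapp_eq oX Xh); exact: pX'.
    - by rewrite {1}XE.
    - by rewrite {1}XE.
  by move=> f; have := pX' f; rewrite innerE lecE => /andP[].
exists (`|M| + 1); first by rewrite ltr_wpDl.
move=> f; have := hM f; rewrite !nrmE -rmorphM lecR => /le_trans; apply.
by rewrite ler_wpM2r ?nrm_ge0// (le_trans (ler_norm _))// lerDl.
Qed.

Lemma opsqrt_bounded (X : set (K * K)) : bounded_nonneg X ->
  let s := opapp (opsqrt X) in
  [/\ opsqrt X = fgraph s, linop s, symop s & forall f, s (s f) = opapp X f].
Proof.
move=> /bounded_nonnegP[XE lx sx px [M M0 bx]] s.
set x := opapp X in XE lx sx px bx *.
have [[[oS dS aS] _] SS] : nonneg_selfadjoint (opsqrt X) /\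
    opcomp (opsqrt X) (opsqrt X) = X.
  apply: opsqrtP.
  (* M^-1 X satisfies the hypothesis of sqrt_exists *)
  pose w f := (M^-1)%:C *: x f.
  have Mi : 0 < M^-1 by rewrite invr_gt0.
  have [||f|p [lp sp pp cp _]] := @sqrt_exists _ _ w.
  - by move=> a u v; rewrite /w lx scalerDr !scalerA mulrC.
  - by move=> u v; rewrite /w !rdotE sx.
  - rewrite nrm_le_sqr ?nrm_ge0// -rdot_nrm.
    rewrite /w !rdotE (rdotC f).
    have := nonneg_sqr_le lx sx px M0 bx f.
    rewrite -ler_pdivrMl//; have := px f.
    move: (rdot (x f) (x f)) (rdot (x f) f) (M^-1) Mi => a b c c0 b0 ab.
    have := ler_wpM2l (ltW c0) ab; have := mulr_ge0 (ltW c0) b0; lra.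
  pose r f := (Num.sqrt M)%:C *: p f.
  have lr : linop r by move=> a u v; rewrite /r lp scalerDr !scalerA mulrC.
  have sr : symop r by move=> u v; rewrite /r !rdotE sp.
  have rr f : r (r f) = x f.
    rewrite /r (linopZ lp) pp scalerA -rmorphM -expr2 sqr_sqrtr ?ltW//.
    by rewrite /w scalerA -rmorphM mulfV ?gt_eqF// scale1r.
  exists (fgraph r); split; first split.
  - exact: fgraph_selfadjoint.
  - apply/nonneg_opP => [|f u g v|f u]; first exact: fgraph_operator.
      by rewrite /fgraph /= => -> ->; exact: sr.
    rewrite /fgraph /= => ->; rewrite /r rdotZl mulr_ge0 ?sqrtr_ge0//.
    have := rdot_le (f - p f) f; have := ler_wpM2r (nrm_ge0 f) (cp f).
    rewrite rdotDl rdotNl rdot_nrm; lra.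
  rewrite XE; apply/seteqP; split=> [[f u] [g]|[f u]].
    by rewrite /fgraph /= => -> ->.
  by rewrite fgraphE => ->; exists (r f); rewrite fgraphE /= ?rr.
have dS' : opdom (opsqrt X) = setT.
  apply/seteqP; split=> // f _.
  have : opcomp (opsqrt X) (opsqrt X) (f, x f) by rewrite SS XE.
  by move=> [u Sf _]; exists u.
have [SE ls] := everywhereE oS dS'.
have Ss f : opsqrt X (f, s f) by rewrite SE fgraphE.
split=> //.
  by move=> u v; apply: (@selfadjoint_sym _ _ (opsqrt X)).
move=> f; have : opcomp (opsqrt X) (opsqrt X) (f, s (s f)) by exists (s f).
by rewrite SS XE.
Qed.

Lemma opnormP (X : set (K * K)) : bounded_nonneg X ->
  0 <= opnorm X /\ forall f, nrm (opapp X f) <= opnorm X * nrm f.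
Proof.
move=> /bounded_nonnegP[XE lx sx px [M M0 bx]].
set x := opapp X in XE lx sx px bx *.
have le1 (f : K) : (`|f| <= 1) = (nrm f <= 1) by rewrite nrmE lecR.
have ub f : nrm f <= 1 -> nrm (x f) <= opnorm X.
  move=> f1; apply: ub_le_sup.
    exists M => _ [g /= + <-]; rewrite le1 => g1.
    by rewrite (le_trans (bx g))// ger_pMr.
  by exists f; rewrite //= le1.
split; first by rewrite (le_trans (nrm_ge0 (x 0)))// ub// nrm0.
move=> f; have [f0|f0] := eqVneq (nrm f) 0.
  by rewrite (nrm_eq0 f0) (linop0 lx) nrm0 mulr0.
have fp : 0 < nrm f by rewrite lt_def f0 nrm_ge0.
have := ub ((nrm f)^-1%:C *: f).
rewrite (linopZ lx) !nrmZr ?invr_ge0 ?nrm_ge0// mulVf// => /(_ (lexx _)).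
by rewrite ler_pdivrMl// mulrC.
Qed.

End Bounded.

(** * Bounded nonnegative extensions of a relation *)

Section Extension.
Variables (R : realType) (K : hilbertType R).

Lemma rdotZr_conj (z : R[i]) (u v : K) : rdot u (z *: v) = rdot (z^*%C *: u) v.
Proof.
rewrite (scale_complexE z v) (scale_complexE (z^*%C) u) !rdotE rdotil.
by case: z => x y /=; lra.
Qed.

Lemma rdot_scale (z : R[i]) (u v : K) :
  rdot (z *: u) (z *: v) = (complex.Re `|z|) ^+ 2 * rdot u v.
Proof.
rewrite rdotZr_conj scalerA.
have -> : z^*%C * z = ((complex.Re `|z|) ^+ 2)%:C.
  case: z => a b; rewrite normc_def /= sqr_sqrtr ?addr_ge0 ?sqr_ge0//.
  by apply/eqP; rewrite eq_complex /=; apply/andP; split; apply/eqP; ring.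
by rewrite rdotZl.
Qed.

(** A linear relation [S] with [|h|^2 <= mu (h, g)] for [(g, h)] in [S]
extends to a bounded nonnegative everywhere defined operator. On [S] the
formula [q p r = (p.2, r.1)] defines a nonnegative symmetric form. The
value of the extension at [g] is the limit of [p.2], where [p] runs through the
elements of [S] that approximately represent the functional [r |-> (r.2, g)]
for [q]. *)
Lemma bounded_nonneg_extension (S : set (K * K)) (mu : R) :
  subspace S -> 0 <= mu ->
  (forall g h, S (g, h) -> `|h| ^+ 2 <= mu%:C * inner h g) ->
  exists X, bounded_nonneg X /\ S `<=` X.
Proof.
move=> sS mu0 hS.
have pS g h : S (g, h) -> 0 <= inner h g.
  move=> Sg; have := hS _ _ Sg; rewrite nrmE -rmorphXn.
  (* for mu = 0 the relation takes only the value 0 *)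
  have [mu1|mu1] := eqVneq mu 0.
    rewrite mu1 mul0r lecR => h0.
    have -> : h = 0.
      by apply/nrm_eq0/eqP; rewrite -sqrf_eq0 eq_le h0 sqr_ge0.
    by rewrite linear0l.
  move=> h0; have mup : 0 < mu by rewrite lt_def mu1.
  rewrite -(@pmulr_rge0 _ mu%:C) ?ltcR// (le_trans _ h0)//.
  by rewrite (@lecR _ 0) sqr_ge0.
pose m := Num.sqrt mu.
have m0 : 0 <= m := sqrtr_ge0 _.
have mu2 : mu = m ^+ 2 by rewrite sqr_sqrtr.
pose q (p r : K * K) := rdot p.2 r.1.
have q0 p : S p -> 0 <= q p p.
  by case: p => g h /pS; rewrite innerE lecE => /andP[].
have qC p r : S p -> S r -> q p r = q r p.
  case: p r => [g h] [g' h'] Sg Sg'; rewrite /q /= (nonneg_sym sS pS Sg Sg').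
  exact: rdotC.
have qlin (a : R) p r s : q (a%:C *: p + r) s = a * q p s + q r s.
  by rewrite /q /= !rdotE.
pose sq p := Num.sqrt (q p p).
have sq0 p : 0 <= sq p := sqrtr_ge0 _.
have F0 p : S p -> nrm p.2 <= m * sq p.
  move=> Sp; rewrite nrm_le_sqr ?mulr_ge0// exprMn !sqr_sqrtr ?q0//.
  case: p Sp => g h Sg; have := hS _ _ Sg.
  rewrite nrmE -rmorphXn -rdot_nrm innerE lecE /= !mul0r subr0.
  by case/andP.
(* p represents r |-> (r.2, g) up to e times the seminorm *)
pose ap g (e : R) p := [/\ 0 < e, S p &
  forall r, S r -> `|q r p - rdot r.2 g| <= e * sq r].
have ex g e : 0 < e -> exists p, ap g e p.
  move=> e0; have [|||p Sp hp] := approx_riesz (l := fun r => rdot r.2 g)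
    (c := mu * nrm g ^+ 2) sS qlin qC q0 _ _ _ e0.
  - by move=> a p r; rewrite /= !rdotE.
  - move=> p Sp; rewrite -[leLHS]real_normK ?num_real//.
    rewrite (@le_trans _ _ ((m * sq p * nrm g) ^+ 2))//.
      rewrite ler_sqr ?nnegrE ?mulr_ge0 ?nrm_ge0//.
      by rewrite (le_trans (cauchy_schwarz _ _))// ler_wpM2r ?nrm_ge0 ?F0.
    by rewrite !exprMn !sqr_sqrtr ?q0// mulrAC.
  - by rewrite mulr_ge0 ?sqr_ge0.
  by exists p.
have /choice[x hx] : forall g, exists h, forall e p, ap g e p ->
    nrm (h - p.2) <= m * e.
  move=> g; pose P (c : R) h := exists e p, [/\ ap g e p, p.2 = h & m * e <= c].
  have [c c0|c d _ _ [e [p [app <- mc]]] [e' [r [apr <- md]]]|h hh] :=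
      @complete_net _ _ P.
  - have d0 : 0 < c / (m + 1) by rewrite divr_gt0// ltr_wpDl.
    have [p app] := ex g _ d0; exists p.2, (c / (m + 1)), p; split=> //.
    by rewrite mulrCA ger_pMr// ler_pdivrMr ?mul1r ?lerDl// ltr_wpDl.
  - apply: le_trans (lerD mc md); rewrite -mulrDr.
    case: app apr => [e0 Sp hp] [e'0 Sr hr].
    have [_ Sl] := sS.
    have Spr : S (p - r).
      by rewrite addrC -scaleN1r; exact: Sl.
    rewrite -/((p - r).2) (le_trans (F0 _ Spr))// ler_wpM2l//.
    apply: (approx_riesz_cauchy sS qlin qC q0 _ _ Sp Sr hp hr); exact: ltW.
  by exists h => e p app; apply: hh; exists e, p.
(* the representative has seminorm at most about m |g| *)
have F1 g e p : ap g e p -> sq p <= m * nrm g + e.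
  move=> [e0 Sp hp]; have := hp _ Sp.
  have := rdot_le p.2 g; have := ler_wpM2r (nrm_ge0 g) (F0 _ Sp).
  rewrite -[q p p]sqr_sqrtr ?q0// -/(sq p) => h1 h2 /ler_normlP[_ h3].
  have : sq p ^+ 2 <= (m * nrm g + e) * sq p by lra.
  have [->|s0] := eqVneq (sq p) 0.
    by move=> _; rewrite addr_ge0 ?mulr_ge0 ?nrm_ge0// ltW.
  by rewrite expr2 ler_pM2r// lt_def s0 sq0.
have sqZ a p : sq (a *: p) = complex.Re `|a| * sq p.
  rewrite /sq /q /= rdot_scale sqrtrM ?sqr_ge0// sqrtr_sqr ger0_norm//.
  by rewrite -lecR RRe_real ?ger0_real//; exact: normr_ge0.
have lx : linop x.
  move=> a g g'; apply/eqP; rewrite -subr_eq0; apply/eqP.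
  pose c := complex.Re `|a|.
  have c0 : 0 <= c by rewrite -lecR RRe_real ?ger0_real//; exact: normr_ge0.
  apply: (@small_nrm_eq0 _ _ _ (2 * (m * (c + 1)))) => e e0.
  have [p app] := ex g _ e0; have [p' app'] := ex g' _ e0.
  have ap2 : ap (a *: g + g') ((c + 1) * e) (a *: p + p').
    case: app app' => [_ Sp hp] [_ Sp' hp']; split.
    - by rewrite mulr_gt0// ltr_wpDl.
    - by case: sS => _; exact.
    move=> r Sr.
    have Sar : S (a^*%C *: r) by case: r Sr => u v; exact: subspaceZ.
    have := hp _ Sar; have := hp' _ Sr; rewrite sqZ.
    have -> : complex.Re `|a^*%C| = c.
      by rewrite /c !normc_def; case: (a) => ? ? /=; rewrite sqrrN.
    have -> : q r (a *: p + p') - rdot r.2 (a *: g + g') =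
       (q (a^*%C *: r) p - rdot (a^*%C *: r).2 g) + (q r p' - rdot r.2 g').
      by rewrite /q /= !rdotE !rdotZr_conj; lra.
    rewrite !ler_norml; lra.
  have := hx _ _ _ ap2; have := hx _ _ _ app'; have := hx _ _ _ app.
  move=> /(ler_wpM2l c0); rewrite -/c -nrmZ scalerBr => h1 h2 h3.
  have := nrm_triangle (a *: p + p').2 (x (a *: g + g')) (a *: x g + x g').
  have := nrmD (a *: p.2 - a *: x g) (p'.2 - x g').
  rewrite addrACA -opprD (nrmBC (a *: p.2)) (nrmBC p'.2) /= => h4 h5.
  lra.
have xS g h : S (g, h) -> x g = h.
  move=> Sg; apply/eqP; rewrite -subr_eq0; apply/eqP.
  apply: (@small_nrm_eq0 _ _ _ m) => e e0; apply: (hx g e (g, h)); split=> //.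
  by move=> r Sr; rewrite subrr normr0 mulr_ge0 ?(ltW e0).
have ex1 g (e : R) : 0 < e ->
    exists d p, [/\ ap g d p, d <= e & sq p <= m * nrm g + 1].
  move=> e0; have d0 : 0 < Num.min e 1 by rewrite lt_min e0 ltr01.
  have [p app] := ex g _ d0; exists (Num.min e 1), p; split=> //.
    by rewrite ge_min lexx.
  by rewrite (le_trans (F1 _ _ _ app))// lerD2l ge_min lexx orbT.
have sx : symop x.
  move=> g g'; apply/eqP; rewrite -subr_eq0; apply/eqP.
  apply: (@small_real_eq0 _ _ (2 * m * (nrm g + nrm g') + 2)) => e e0.
  have [d [p [app de pg]]] := ex1 g _ e0.
  have [d' [p' [app' de' pg']]] := ex1 g' _ e0.
  have := hx _ _ _ app; have := hx _ _ _ app'.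
  case: app app' => [d0 Sp hp] [d0' Sp' hp'].
  have := hp _ Sp'; have := hp' _ Sp; rewrite (qC p p')// => h1 h2 h3 h4.
  have h5 : d' * sq p <= e * (m * nrm g + 1) by rewrite ler_pM// ltW.
  have h6 : d * sq p' <= e * (m * nrm g' + 1) by rewrite ler_pM// ltW.
  have := cauchy_schwarz (x g - p.2) g'; have := cauchy_schwarz (x g' - p'.2) g.
  have h7 : nrm (x g - p.2) * nrm g' <= m * e * nrm g'.
    by rewrite ler_wpM2r ?nrm_ge0// (le_trans h4)// ler_wpM2l.
  have h8 : nrm (x g' - p'.2) * nrm g <= m * e * nrm g.
    by rewrite ler_wpM2r ?nrm_ge0// (le_trans h3)// ler_wpM2l.
  move: h1 h2; rewrite (rdotC g) !rdotE !ler_norml; lra.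
have px g : 0 <= rdot (x g) g.
  apply: (@le_small _ _ _ (2 * m * nrm g + 1)) => e e0.
  have [d [p [app de pg]]] := ex1 g _ e0.
  have := hx _ _ _ app; case: app => [d0 Sp hp] h1.
  have := hp _ Sp; have := q0 _ Sp.
  have h2 : d * sq p <= e * (m * nrm g + 1) by rewrite ler_pM// ltW.
  have := cauchy_schwarz (x g - p.2) g.
  have h3 : nrm (x g - p.2) * nrm g <= m * e * nrm g.
    by rewrite ler_wpM2r ?nrm_ge0// (le_trans h1)// ler_wpM2l.
  rewrite !rdotE !ler_norml; lra.
have ox := fgraph_operator lx.
exists (fgraph x); split; last by move=> [g h] /xS.
split=> //.
- by apply/seteqP; split=> // g _; exists (x g).
- exists mu => g; rewrite (opapp_eq ox (erefl : fgraph x (g, x g))).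
  rewrite !nrmE -rmorphM lecR; apply: (@le_small _ _ _ (2 * m)) => e e0.
  have [p app] := ex g _ e0; have := hx _ _ _ app; have := F1 _ _ _ app.
  case: app => _ Sp _ /(ler_wpM2l m0) h1 h2; have := F0 _ Sp.
  have := nrmD (x g - p.2) p.2; rewrite subrK mu2; lra.
- apply/nonneg_opP => // [f u g v|f u]; rewrite !fgraphE => ->//.
  by move=> ->; exact: sx.
Qed.

End Extension.

(** * The operator B^* X^{1/2} C, where C is the closure of X^{1/2} B *)

Section Factorization.
Variables (R : realType) (H K : hilbertType R).
Variables (T B : set (H * K)) (X : set (K * K)).
Hypotheses (hT : closed_densely_defined T) (hB : closed_densely_defined B).
Hypotheses (hX : bounded_nonneg X) (XBT : opcomp X B `<=` T).

Local Notation x := (opapp X).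
Local Notation s := (opapp (opsqrt X)).
Local Notation lam := (opnorm X).

Let oT : is_operator T. Proof. by case: hT. Qed.
Let oB : is_operator B. Proof. by case: hB. Qed.
Let sT : subspace T. Proof. by case: oT. Qed.
Let sB : subspace B. Proof. by case: oB. Qed.
Let dT : dense (opdom T). Proof. by case: hT. Qed.
Let dB : dense (opdom B). Proof. by case: hB. Qed.
Let XE : X = fgraph x. Proof. by case: (bounded_nonnegP hX). Qed.
Let lx : linop x. Proof. by case: (bounded_nonnegP hX). Qed.
Let sx : symop x. Proof. by case: (bounded_nonnegP hX). Qed.
Let SE : opsqrt X = fgraph s. Proof. by case: (opsqrt_bounded hX). Qed.
Let ls : linop s. Proof. by case: (opsqrt_bounded hX). Qed.
Let ss : symop s. Proof. by case: (opsqrt_bounded hX). Qed.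
Let sE f : s (s f) = x f. Proof. by case: (opsqrt_bounded hX). Qed.
Let lam0 : 0 <= lam. Proof. by case: (opnormP hX). Qed.

Let Xx g : X (g, x g). Proof. by rewrite {1}XE. Qed.
Let Ss g : opsqrt X (g, s g). Proof. by rewrite {1}SE. Qed.

Let Xfun g k : X (g, k) -> k = x g. Proof. by rewrite {1}XE. Qed.
Let Sfun g k : opsqrt X (g, k) -> k = s g. Proof. by rewrite {1}SE. Qed.

Let TB f b : B (f, b) -> T (f, x b).
Proof. by move=> Bf; apply: XBT; exists b. Qed.

Let s_le g : rdot (s g) (s g) <= lam * rdot g g.
Proof.
have [_ bx] := opnormP hX.
rewrite ss sE rdotC (le_trans (rdot_le _ _))// rdot_nrm expr2 mulrA.
by rewrite ler_wpM2r ?nrm_ge0.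
Qed.

Let s_bound g : nrm (s g) <= (lam + 1) * nrm g.
Proof.
rewrite nrm_le_sqr ?mulr_ge0 ?nrm_ge0 ?addr_ge0// (le_trans (s_le _))//.
rewrite rdot_nrm exprMn ler_wpM2r ?sqr_ge0//; have := lam0; nra.
Qed.

Local Notation C0 := (opcomp (opsqrt X) B).
Local Notation C := (opclosure C0).

Let C0E f c : C0 (f, c) <-> exists2 b, B (f, b) & c = s b.
Proof.
by split=> [[b Bf /Sfun/= ->]|[b Bf ->]]; exists b.
Qed.

Let sC0 : subspace C0.
Proof.
apply/operator_subspace/operator_comp => //.
by rewrite SE; exact: fgraph_operator.
Qed.

Let sC : subspace C. Proof. exact: closure_subspace. Qed.

(** [X^{1/2} C] is contained in [T], as [T] is closed. *)
Let CT f c : C (f, c) -> T (f, s c).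
Proof.
move=> /closure_pairP cl; case: hT => _ cT _.
rewrite (closure_id T).1//; apply/closure_pairP => e e0.
have l1 : 0 < lam + 1 by rewrite ltr_wpDl.
have d0 : 0 < Num.min e (e / (lam + 1)) by rewrite lt_min e0 divr_gt0.
have [g [d [/C0E[b Bg ->] fg cd]]] := cl _ d0.
exists g, (x b); split; first exact: TB.
  by rewrite (le_trans fg)// ge_min lexx.
rewrite -sE -(linopB ls) (le_trans (s_bound _))// -ler_pdivlMl//.
by rewrite (le_trans cd)// ge_min mulrC lexx orbT.
Qed.

Lemma closure_sqrt_comp : closed_densely_defined C.
Proof.
split; last 2 first.
- exact: closed_closure.
- apply/denseP => f e e0; have [g [b Bg] fg] := (denseP _).1 dB f e e0.
  by exists g => //; exists (s b); apply: subset_closure; apply/C0E; exists b.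
apply: operatorP => // h Ch.
(* the limit h lies in the closure of the range of s, and is killed by s *)
have sh : s h = 0.
  have := CT Ch; case: oT => T0 _ fT /fT; exact.
apply: (@small_nrm_eq0 _ _ _ 1) => e e0; rewrite mul1r.
have [g [d [/C0E[b Bg ->] _ hd]]] := (closure_pairP _ _ _).1 Ch _ e0.
rewrite (le_trans _ hd)// nrm_le_sqr ?nrm_ge0// -rdot_nrm.
have := rdot_ge0 (s b).
have : rdot h (s b) = 0 by rewrite -ss sh rdot0l.
by rewrite !rdotE (rdotC (s b) h) => ->; lra.
Qed.

Let hC := closure_sqrt_comp.

Let adjC (k : K) (h : H) : adj C (k, h) <-> adj B (s k, h).
Proof.
rewrite adj_closure//; split=> [/(adjP _ _ sC0) a|/(adjP _ _ sB) a].
  by apply/(adjP _ _ sB) => f b Bf; rewrite -ss; apply: a; apply/C0E; exists b.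
by apply/(adjP _ _ sC0) => f c /C0E[b Bf ->]; rewrite ss; exact: a.
Qed.

Local Notation A := (opcomp (adj B) (opcomp (opsqrt X) C)).

Let AE : A = opcomp (adj C) C.
Proof.
apply/seteqP; split=> [[f h] [k [c Cf /Sfun/= ->] Bk]|[f h] [c Cf Dc]].
  by exists c => //; exact/adjC.
by exists (s c); [exists c | exact/adjC].
Qed.

Lemma factor_nonneg_selfadjoint : nonneg_selfadjoint A.
Proof. by rewrite AE; exact: nonneg_selfadjoint_adj_comp. Qed.

Lemma form_bounds f : opdom B f ->
  0 <= inner (opapp T f) (opapp B f) /\
  inner (opapp T f) (opapp B f) <= lam%:C * `|opapp B f| ^+ 2.
Proof.
move=> [b Bf]; rewrite (opapp_eq oB Bf) (opapp_eq oT (TB Bf)).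
have [oX dX _ /(_ b) pX] := hX.
have xb : 0 <= inner (x b) b by apply: pX; rewrite dX.
split=> //; rewrite -(RRe_real (ger0_real xb)) nrmE -rmorphXn -rmorphM lecR.
by rewrite -rdot_nrm -/(rdot _ _) -sE ss; exact: s_le.
Qed.

Lemma adj_comp_sub : opcomp (adj T) B `<=` opcomp (adj B) (opcomp X B).
Proof.
move=> [f h] [b Bf /(adjP _ _ sT) Tb]; exists (x b); first by exists b.
by apply/(adjP _ _ sB) => g d Bg; rewrite -sx; apply: Tb; exact: TB.
Qed.

Lemma adj_comp_sub_factor : opcomp (adj T) B `<=` A.
Proof.
move=> p /adj_comp_sub; case: p => f h [k [b Bf /Xfun/= ->] Bk].
exists (x b) => //.
rewrite -sE; exists (s b) => //; apply: subset_closure.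
by apply/C0E; exists b.
Qed.

Lemma factor_sub : A `<=` opcomp (adj B) T.
Proof.
move=> [f h] [k [c Cf /Sfun/= ->] Bk].
by exists (s c) => //; exact: CT.
Qed.

Lemma adj_comp_symmetric : symmetric_op (opcomp (adj T) B).
Proof.
have oTB : is_operator (opcomp (adj T) B).
  by apply: operator_comp => //; exact: adj_operator.
split=> // f g [u Sf] [v Sg].
rewrite (opapp_eq oTB Sf) (opapp_eq oTB Sg).
have [[oA dA aA] _] := factor_nonneg_selfadjoint.
have := adj_comp_sub_factor Sg; rewrite -{1}aA.
apply; exact: adj_comp_sub_factor.
Qed.

Lemma adjsq_le_factor : adjsq_le T lam A.
Proof.
have hA := factor_nonneg_selfadjoint.
have [oS _ SC] := opsqrt_adj_comp hC; rewrite -AE in oS SC.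
split=> // [f [w /SC[c Cf _]]|f [w Sf]]; first by exists (s c); exact: CT.
have [c Cf cw] := SC _ _ Sf.
rewrite (opapp_eq oT (CT Cf)) (opapp_eq oS Sf) !nrmE -!rmorphXn -rmorphM lecR.
by rewrite -cw -!rdot_nrm.
Qed.

Lemma le_adjsq_factor : le_adjsq lam A (lam ^+ 2) B.
Proof.
have hA := factor_nonneg_selfadjoint.
have [oS CS _] := opsqrt_adj_comp hC; rewrite -AE in oS CS.
have BC f b : B (f, b) -> C (f, s b).
  by move=> Bf; apply: subset_closure; apply/C0E; exists b.
split=> // [f [b /BC/CS[w Sf _]]|f [b Bf]]; first by exists w.
have [w Sf wb] := CS _ _ (BC _ _ Bf).
rewrite (opapp_eq oB Bf) (opapp_eq oS Sf) !nrmE -!rmorphXn -!rmorphM lecR.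
by rewrite wb -!rdot_nrm expr2 -mulrA ler_wpM2l.
Qed.

Lemma selfadjoint_adj_comp : selfadjoint (opcomp (adj T) B) ->
  [/\ opcomp (adj T) B = A, A = opcomp (adj B) T
    & opcomp (adj T) B = opcomp (adj B) (opcomp X B)].
Proof.
move=> [oTB dTB aTB].
(* B^* T is contained in the adjoint of T^* B *)
have BT : opcomp (adj B) T `<=` opcomp (adj T) B.
  rewrite -[X in _ `<=` X]aTB => -[f h] [t Tf Bt].
  apply/(adjP _ _ (operator_subspace oTB)) => g k [b Bg /(adjP _ _ sT) Tb].
  by have := Tb _ _ Tf; have := (adjP _ _ sB).1 Bt _ _ Bg;
    rewrite (rdotC t) (rdotC f) => <- ->.
have BXB : opcomp (adj B) (opcomp X B) `<=` opcomp (adj B) T.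
  by move=> [f h] [k Xk Bk]; exists k => //; exact: XBT.
split; apply/seteqP; split.
- exact: adj_comp_sub_factor.
- exact: subset_trans factor_sub BT.
- exact: factor_sub.
- exact: subset_trans BT adj_comp_sub_factor.
- exact: adj_comp_sub.
- exact: subset_trans BXB BT.
Qed.

End Factorization.

Theorem corollary2p1 (R : realType) (H K : hilbertType R)
    (T B : set (H * K))
    (hT : closed_densely_defined T) (hB : closed_densely_defined B) :
  ((exists X : set (K * K), bounded_nonneg X /\ opcomp X B `<=` T) <->
   (opdom B `<=` opdom T /\
    exists mu : R, 0 <= mu /\
      forall f, opdom B f ->
        `|opapp T f| ^+ 2 <= mu%:C * inner (opapp T f) (opapp B f))) /\
  forall X : set (K * K), bounded_nonneg X -> opcomp X B `<=` T ->
  let lam := opnorm X in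
  let C := opclosure (opcomp (opsqrt X) B) in
  let A := opcomp (adj B) (opcomp (opsqrt X) C) in
  [/\ 0 <= lam, is_operator C & nonneg_selfadjoint A] /\
  [/\ (* (1) *)
      forall f, opdom B f ->
        0 <= inner (opapp T f) (opapp B f) /\
        inner (opapp T f) (opapp B f) <= lam%:C * `|opapp B f| ^+ 2,
      (* (2) *)
      [/\ symmetric_op (opcomp (adj T) B),
          opcomp (adj T) B `<=` A & A `<=` opcomp (adj B) T],
      (* (3) *)
      adjsq_le T lam A /\ le_adjsq lam A (lam ^+ 2) B
    & (* (4) *)
      selfadjoint (opcomp (adj T) B) ->
      [/\ opcomp (adj T) B = A, A = opcomp (adj B) T,
          adjsq_le T lam (opcomp (adj T) B),
          opscale lam (opcomp (adj T) B) =
            opscale lam (opcomp (adj B) (opcomp X B))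
        & le_adjsq lam (opcomp (adj B) (opcomp X B)) (lam ^+ 2) B]].
Proof.
have [oT _ _] := hT; have [oB _ _] := hB.
have sT := operator_subspace oT; have sB := operator_subspace oB.
split; first split.
- move=> [X [hX XBT]].
  have [XE lx sx px [M M0 bx]] := bounded_nonnegP hX.
  have TB f b : B (f, b) -> T (f, opapp X b).
    by move=> Bf; apply: XBT; exists b => //; rewrite {1}XE.
  split=> [f [b Bf]|]; first by exists (opapp X b); exact: TB.
  exists M; split=> [|f [b Bf]]; first exact: ltW.
  have := form_bounds hT hB hX XBT (ex_intro _ b Bf).
  rewrite (opapp_eq oB Bf) (opapp_eq oT (TB _ _ Bf)) => -[xb _].
  rewrite -(RRe_real (ger0_real xb)) nrmE -rmorphXn -rmorphM lecR.
  by rewrite -rdot_nrm; exact: nonneg_sqr_le.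
- move=> [BT [mu [mu0 hmu]]].
  (* the relation mapping B f to T f *)
  pose S : set (K * K) := [set p | exists2 f, B (f, p.1) & T (f, p.2)].
  have sS : subspace S.
    split; first by exists 0; [case: sB|case: sT].
    move=> a [u v] [u' v'] [f Bf Tf] [g Bg Tg]; exists (a *: f + g).
      by case: sB => _ /(_ a _ _ Bf Bg).
    by case: sT => _ /(_ a _ _ Tf Tg).
  have [|X [hX SX]] := bounded_nonneg_extension sS mu0.
    move=> u v [f Bf Tf]; have := hmu f (ex_intro _ u Bf).
    by rewrite (opapp_eq oB Bf) (opapp_eq oT Tf).
  exists X; split=> // -[f v] [u Bf Xu].
  have [w Tf] := BT f (ex_intro _ u Bf).
  have [[_ _ fX] _ _ _] := hX.
  suff -> : v = w by [].
  by apply: fX Xu _; apply: SX; exists f.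
move=> X hX XBT lam C A.
have hA := factor_nonneg_selfadjoint hT hB hX XBT.
have lo := adjsq_le_factor hT hB hX XBT.
have up := le_adjsq_factor hT hB hX XBT.
split; split=> //.
- by have [] := opnormP hX.
- by have [] := closure_sqrt_comp hT hB hX XBT.
- exact: form_bounds.
- split.
  + exact: adj_comp_symmetric hX XBT.
  + exact: adj_comp_sub_factor.
  + exact: factor_sub.
move=> /(selfadjoint_adj_comp hT hB hX XBT)[TA AT TX].
by split; rewrite -?TX ?TA.
Qed.
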